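(* Let $p\in\mathbb{R}$, $T>0$, let $u:\mathbb{R}^d\to\mathcal{S}_p$ be measurable, let $\sigma_{ij},b_i:\mathbb{R}^d\times\mathcal{S}_p\to\mathbb{R}$ ($i,j=1,\dots,d$) satisfy a $(p,q)$ local Lipschitz condition uniformly in $x\in\mathbb{R}^d$, where $q\le p-1$, and let $c(t,x,y)\in\mathbb{R}$ ($0\le t\le T$, $x\in\mathbb{R}^d$, $y\in C([0,T],\mathcal{S}_p)$) satisfy, for each $x\in\mathbb{R}^d$: (1) there is $\beta$ with $|c(t,x,y_1)-c(t,x,y_2)|\le\beta\|y_1-y_2\|_t$ for all $0\le t\le T$ and $y_1,y_2\in C([0,T],\mathcal{S}_p)$; (2) for every $\alpha>0$ there is $M(\alpha,T)$ with $|c(t,x,y)|\le M(\alpha,T)$ for all $0\le t\le T$ and all $y$ with $\|y\|_T\le\alpha$. Let $u(t,x)$ be a solution of $$\partial_t u(t,x)=L(x,u(t,x)),\qquad u(0,x)=u(x). \qquad (\mathrm{I})$$ Then $$\hat u(t,x):=u(t,x)\,e^{\int_0^t c(s,x,u(\cdot,x))\,ds}$$ satisfies $$\partial_t\hat u(t,x)=\hat L(t,x,\hat u(\cdot,x)),\qquad \hat u(0,x)=u(x). \qquad (\mathrm{II})$$ If equation (I) has a unique solution, then so has equation (II).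
   Context: Spaces: $\mathcal{S}_p$, $p\in\mathbb{R}$, are the Hermite–Sobolev spaces on $\mathbb{R}^d$: the completion of the Schwartz space $\mathcal{S}$ in the norm $\|f\|_p^2=\sum_{k\in\mathbb{Z}_+^d}(2|k|+d)^{2p}\langle f,h_k\rangle^2$, where $h_k$ are the Hermite functions (an orthonormal basis of $L^2(\mathbb{R}^d)$) and $|k|=k_1+\dots+k_d$; they are separable real Hilbert spaces, and $\partial_i:\mathcal{S}_p\to\mathcal{S}_{p-1/2}$ are bounded. For a path $y$ with values in $\mathcal{S}_p$, $\|y\|_s:=\sup_{v\le s}\|y(v)\|_p$ and $y_s:=y(s)$. For each $x,y$ the map $s\mapsto c(s,x,y)$ is assumed Borel measurable. Lipschitz condition: $f$ satisfies a $(p,q)$ local Lipschitz condition uniformly in $x$ if for every $\lambda>0$ there is $C=C(\lambda,p,q)$ with $|f(x,\varphi)-f(x,\psi)|\le C\|\varphi-\psi\|_q$ for all $x\in\mathbb{R}^d$ and all $\varphi,\psi\in B_p(0,\lambda)$, the ball of radius $\lambda$ centred at $0$ in $\mathcal{S}_p$. Operators: $L(x,\cdot):\mathcal{S}_p\to\mathcal{S}_{p-1}$, $L(x,y):=\frac12\sum_{i,j=1}^d(\sigma\sigma^t)_{ij}(x,y)\,\partial^2_{ij}y-\sum_{i=1}^d b_i(x,y)\,\partial_i y$. For fixed $x$ and $y\in C([0,T],\mathcal{S}_p)$ let $\hat y\in C([0,T],\mathcal{S}_p)$ be the unique solution of $\hat y(t)=y(t)e^{-\int_0^tc(s,x,\hat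 y)\,ds}$, $0\le t\le T$, and put $\hat\sigma_{ij}(s,x,y):=\sigma_{ij}(x,\hat y(s))$, $\hat b_i(s,x,y):=b_i(x,\hat y(s))$, $\hat c(s,x,y):=c(s,x,\hat y)$, and $\hat L(s,x,y):=\frac12\sum_{i,j=1}^d(\hat\sigma\hat\sigma^t)_{ij}(s,x,y)\,\partial^2_{ij}y_s-\sum_{i=1}^d\hat b_i(s,x,y)\,\partial_iy_s+\hat c(s,x,y)\,y_s$. (The function $\hat u(t,x)$ in the claim is defined by the explicit formula given there, with a plus sign in the exponent; it is not the path transform $y\mapsto\hat y$ applied to $u(\cdot,x)$.) Solutions: a solution of (I) is, for each $x\in\mathbb{R}^d$, a continuous map $u(\cdot,x):[0,T]\to\mathcal{S}_p$ with $u(t,x)=u(x)+\int_0^tL(x,u(s,x))\,ds$ for $0\le t\le T$, the equality holding in $\mathcal{S}_q$. Solutions of (II) are defined in the same way with integrand $\hat L(s,x,\hat u(\cdot,x))$.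
   Formalization: The path ŷ need not exist on all of [0,T] under (1) and (2) (e.g. c(t,x,y) = −‖y‖_t, y constant and large), so a solution of (II) is here required to have its transform ŷ defined; this is proved for û and is automatic whenever every path y has a ŷ. *)

(* Defs.v *)
From HB Require Import structures.
From mathcomp Require Import all_boot all_order all_algebra.
From mathcomp Require Import all_classical all_reals all_analysis.
From mathcomp Require Import zify ring.

Set Implicit Arguments.
Unset Strict Implicit.
Unset Printing Implicit Defensive.

Import Order.TTheory GRing.Theory Num.Theory.
Import numFieldNormedType.Exports.

Local Open Scope classical_set_scope.
Local Open Scope ring_scope.

Section partial_derivatives.
Context {R : realType} {d : nat}.
Implicit Types (f g : 'rV[R]_d -> R^o) (s : seq 'I_d).

Definition pderiv (i : 'I_d) f : 'rV[R]_d -> R^o :=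
  fun x => 'D_(delta_mx 0 i) f x.

Definition pderivs s f : 'rV[R]_d -> R^o := foldr pderiv f s.

Definition monomial (a : 'I_d -> nat) (x : 'rV[R]_d) : R :=
  \prod_(i < d) x 0 i ^+ a i.

(* The order in which the partial derivatives of a word [s] are taken is
   immaterial for smooth functions. *)
Definition smooth f := forall s x, differentiable (pderivs s f) x.

Definition rapidly_decreasing f := forall (a : 'I_d -> nat) s,
  exists C : R, forall x, `|monomial a x * pderivs s f x| <= C.

Definition is_schwartz f := smooth f /\ rapidly_decreasing f.

Lemma pderivsD s f g : smooth f -> smooth g ->
  pderivs s (f + g) = pderivs s f + pderivs s g.
Proof.
move=> sf sg; elim: s => [//|i s IH] /=; rewrite IH; apply/funext => x.
rewrite /pderiv deriveD//; apply: diff_derivable; [exact: sf|exact: sg].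
Qed.

Lemma pderivsZ s (k : R) f : smooth f -> pderivs s (k *: f) = k *: pderivs s f.
Proof.
move=> sf; elim: s => [//|i s IH] /=; rewrite IH; apply/funext => x.
by rewrite /pderiv deriveZ//; apply: diff_derivable; exact: sf.
Qed.

Lemma pderivs_rcons s i f : pderivs (rcons s i) f = pderivs s (pderiv i f).
Proof. by rewrite /pderivs -cats1 foldr_cat. Qed.

Lemma is_schwartz_pderiv i f : is_schwartz f -> is_schwartz (pderiv i f).
Proof.
move=> [sf rf]; split=> [s x|a s]; first by rewrite -pderivs_rcons; exact: sf.
by rewrite -pderivs_rcons; exact: rf.
Qed.

Lemma pderivs0 s : pderivs s (0 : 'rV[R]_d -> R^o) = 0.
Proof.
elim: s => [//|i s IH] /=; rewrite IH; apply/funext => x.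
exact: derive_cst.
Qed.

Lemma is_schwartz0 : is_schwartz 0.
Proof.
split=> [s x|a s]; first by rewrite pderivs0; exact: differentiable_cst.
by exists 0 => x; rewrite pderivs0 mulr0 normr0.
Qed.

Lemma is_schwartzP (k : R) f g :
  is_schwartz f -> is_schwartz g -> is_schwartz (k *: f + g).
Proof.
move=> [sf rf] [sg rg].
have skf : smooth (k *: f).
  by move=> s x; rewrite pderivsZ//; exact: differentiableZ.
split=> [s x|a s].
  by rewrite pderivsD//; apply: differentiableD => //; exact: sg.
have [C hC] := rf a s; have [C' hC'] := rg a s.
exists (`|k| * C + C') => x; rewrite pderivsD// pderivsZ//=.
rewrite [X in _ * X](_ : _ = k * pderivs s f x + pderivs s g x)//.
rewrite mulrDr mulrCA (le_trans (ler_normD _ _))// lerD//.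
by rewrite normrM ler_wpM2l.
Qed.

Definition schwartz_pred : {pred 'rV[R]_d -> R^o} :=
  [pred f | `[< is_schwartz f >]].

Lemma schwartz_submod_closed : submod_closed schwartz_pred.
Proof.
split; first by apply/asboolP; exact: is_schwartz0.
by move=> k f g /asboolP sf /asboolP sg; apply/asboolP; exact: is_schwartzP.
Qed.

HB.instance Definition _ :=
  GRing.isSubmodClosed.Build R ('rV[R]_d -> R^o) schwartz_pred
    schwartz_submod_closed.

End partial_derivatives.

Record schwartz (R : realType) (d : nat) := Schwartz {
  schwartz_fun :> 'rV[R]_d -> R^o;
  schwartz_funP : schwartz_fun \in schwartz_pred }.

HB.instance Definition _ R d := [isSub for @schwartz_fun R d].
HB.instance Definition _ R d := [Choice of schwartz R d by <:].
HB.instance Definition _ R d :=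
  [SubChoice_isSubLmodule of schwartz R d by <:].

Section gaussian.
Context {R : realType}.
Implicit Types (p : {poly R}) (t : R).

Definition gaussian p t : R := p.[t] * expR (- (t ^+ 2 / 2)).

Definition gaussian_deriv p : {poly R} := p^`() - 'X * p.

Lemma is_derive_gaussian p t :
  is_derive t 1 (gaussian p : R -> R) (gaussian (gaussian_deriv p) t).
Proof.
pose e (u : R) : R := - (u ^+ 2 / 2).
have de : is_derive t 1 (e : R -> R) (- t).
  have -> : e = - (2^-1 *: (id ^+ 2)) :> (R -> R).
    by apply/funext => u; rewrite /e mulrC !fctE.
  by apply: trigger_derive; rewrite /GRing.scale/= expr1; field.
have -> : gaussian p = horner p * (expR \o e) by [].
have dE : is_derive t 1 ((expR \o e) : R -> R) (- t * expR (e t)).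
  apply: DeriveDef.
    apply/derivable1_diffP/differentiable_comp; first exact/derivable1_diffP.
    by apply/derivable1_diffP; exact: ex_derive.
  rewrite -derive1E derive1_comp; [|exact: ex_derive|exact: ex_derive].
  by rewrite !derive1E !derive_val mulrC.
apply: trigger_derive.
rewrite /gaussian /gaussian_deriv !hornerE /GRing.scale/= -/(e t).
by ring.
Qed.

Lemma gaussian_bounded p : exists C : R, forall t, `|gaussian p t| <= C.
Proof.
have bX n : exists C : R, forall t, `|t ^+ n * expR (- (t ^+ 2 / 2))| <= C.
  exists (1 + n.+1`!%:R * 2 ^+ n.+1) => t; set s := t ^+ 2 / 2.
  have s0 : 0 <= s by rewrite divr_ge0// sqr_ge0.
  have es : s ^+ n.+1 <= n.+1`!%:R * expR s.
    have := expR_ge1Dxn n s0 => h.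
    rewrite -ler_pdivrMl ?ltr0n ?fact_gt0// mulrC.
    by rewrite (le_trans _ h)// lerDr.
  have e1 : expR (- s) <= 1 by rewrite expR_le1 oppr_le0.
  rewrite normrM [X in _ * X]ger0_norm ?expR_ge0// normrX.
  have tn : `|t| ^+ n <= 1 + (t ^+ 2) ^+ n.+1.
    have [t1|t1] := leP `|t| 1.
      by rewrite (@le_trans _ _ 1) ?exprn_ile1// lerDl exprn_ge0 ?sqr_ge0.
    rewrite -real_normK ?num_real// -exprM.
    rewrite (@le_trans _ _ (`|t| ^+ (2 * n.+1)))// ?lerDr//.
    by rewrite ler_weXn2l ?(ltW t1)//; lia.
  rewrite (le_trans (ler_wpM2r (expR_ge0 _) tn))// mulrDl mul1r lerD//.
  have -> : t ^+ 2 = 2 * s by rewrite /s; field.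
  rewrite exprMn -mulrA [leRHS]mulrC ler_wpM2l ?exprn_ge0//.
  by rewrite expRN ler_pdivrMr ?expR_gt0.
rewrite -[p]coefK poly_def.
elim/big_ind: _ => [|f g [C hC] [C' hC']|i _].
- by exists 0 => t; rewrite /gaussian horner0 mul0r normr0.
- exists (C + C') => t; rewrite /gaussian hornerD mulrDl.
  by rewrite (le_trans (ler_normD _ _))// lerD//; [exact: hC|exact: hC'].
- have [C hC] := bX i; exists (`|p`_i| * C) => t.
  by rewrite /gaussian !hornerE -mulrA normrM ler_wpM2l.
Qed.

Context {d : nat}.
Implicit Types (P : 'I_d -> {poly R}).

Definition gaussian_prod P : 'rV[R]_d -> R^o :=
  fun x => \prod_(i < d) gaussian (P i) (x 0 i).

Lemma differentiable_gaussian_prod P x : differentiable (gaussian_prod P) x.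
Proof.
rewrite /gaussian_prod.
suff : forall r : seq 'I_d, differentiable
    ((fun y : 'rV[R]_d => \prod_(i <- r) gaussian (P i) (y 0 i)) : 'rV[R]_d -> R^o) x.
  exact.
elim=> [|i r IH].
  rewrite (_ : (fun _ => _) = cst 1); first exact: differentiable_cst.
  by apply/funext => y; rewrite big_nil.
rewrite (_ : (fun _ => _) = (gaussian (P i) \o (fun y : 'rV[R]_d => y 0 i)) *
    (fun y => \prod_(i <- r) gaussian (P i) (y 0 i)) :> ('rV[R]_d -> R)).
  apply: differentiableM => //; apply: differentiable_comp.
    exact: differentiable_coord.
  by apply/derivable1_diffP; have [] := is_derive_gaussian (P i) (x 0 i).
by apply/funext => y; rewrite big_cons.
Qed.

Lemma pderiv_gaussian_prod i P : pderiv i (gaussian_prod P) =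
  gaussian_prod (fun j => if j == i then gaussian_deriv (P j) else P j).
Proof.
apply/funext => x; rewrite /gaussian_prod (bigD1 i)//= eqxx.
set c := \prod_(j < d | _) _.
have -> : c = \prod_(j < d | j != i) gaussian (P j) (x 0 j).
  by apply: eq_bigr => j /negbTE ->.
move: c => _; set c := \prod_(j < d | _) _.
have dg := is_derive_gaussian (P i) (x 0 i).
transitivity ('D_1 (c *: (gaussian (P i) : R -> R)) (x 0 i)); last first.
  by rewrite derive_val /GRing.scale/= mulrC.
rewrite /pderiv /derive; set F := (X in lim (X @ _) = _).
set G := (X in _ = lim (X @ _)); suff -> : F = G by [].
apply/funext => h; rewrite {}/F {}/G /=.
congr (h^-1 *: (_ - _)); last by rewrite (bigD1 i)//= mulrC.
rewrite (bigD1 i)//= !mxE !eqxx mulrC; congr (_ * _).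
apply: eq_bigr => j ji; rewrite !mxE /= (negbTE ji) /=.
by rewrite mulr0 add0r.
Qed.

Lemma is_schwartz_gaussian_prod P : is_schwartz (gaussian_prod P).
Proof.
have D s : forall P, exists Q, pderivs s (gaussian_prod P) = gaussian_prod Q.
  elim/last_ind: s => [|s i IH] {}P; first by exists P.
  by rewrite pderivs_rcons pderiv_gaussian_prod.
split=> [s x|a s]; have [Q ->] := D s P; first exact: differentiable_gaussian_prod.
have [C hC] := choice (fun i => gaussian_bounded ('X^(a i) * Q i)).
exists (\prod_(i < d) C i) => x.
rewrite /monomial /gaussian_prod -big_split/= normr_prod ler_prod// => i _.
rewrite normr_ge0/=; apply: le_trans (hC i (x 0 i)).
by rewrite /gaussian hornerM hornerXn mulrA.
Qed.

End gaussian.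

Section hermite.
Context {R : realType}.

Fixpoint hermite_poly (n : nat) : {poly R} :=
  if n is m.+1 then 2%:P * 'X * hermite_poly m - (hermite_poly m)^`() else 1.

Definition hermite1 (n : nat) (t : R) : R :=
  (Num.sqrt (Num.sqrt pi * 2 ^+ n * n`!%:R))^-1 *
  (hermite_poly n).[t] * expR (- (t ^+ 2 / 2)).

Context {d : nat}.
Implicit Types k : {ffun 'I_d -> nat}.

Definition hermite_fun k : 'rV[R]_d -> R^o :=
  fun x => \prod_(i < d) hermite1 (k i) (x 0 i).

Lemma hermite_fun_schwartz k : hermite_fun k \in schwartz_pred.
Proof.
apply/asboolP.
rewrite (_ : hermite_fun k = gaussian_prod (fun i =>
  (Num.sqrt (Num.sqrt pi * 2 ^+ k i * (k i)`!%:R))^-1 *: hermite_poly (k i))).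
  exact: is_schwartz_gaussian_prod.
by apply/funext => x; apply: eq_bigr => i _; rewrite /gaussian hornerZ.
Qed.

Definition hermite k : schwartz R d := Schwartz (hermite_fun_schwartz k).

End hermite.

Section distributions.
Context {R : realType} {d : nat}.
Local Notation dist := (schwartz R d -> R^o).
Implicit Types (phi : schwartz R d) (f y : dist) (p q : R).

Lemma pderiv_schwartz (i : 'I_d) phi : pderiv i phi \in schwartz_pred.
Proof.
by apply/asboolP/is_schwartz_pderiv/asboolP; exact: schwartz_funP.
Qed.

Definition spartial (i : 'I_d) phi : schwartz R d :=
  Schwartz (pderiv_schwartz i phi).

Definition schwartz_seminorm (a : 'I_d -> nat) (s : seq 'I_d) phi : R :=
  sup [set `|monomial a x * pderivs s phi x| | x in [set: 'rV[R]_d]].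

(* Tempered distributions: the linear functionals on the Schwartz space that
   are continuous for the topology of the seminorms [schwartz_seminorm]. *)
Definition tempered f := linear f /\
  exists (l : seq (('I_d -> nat) * seq 'I_d)) (C : R), forall phi,
    `|f phi| <= C * \sum_(as_ <- l) schwartz_seminorm as_.1 as_.2 phi.

(* The Lebesgue integral on R^n as an iterated integral; it is only applied
   to products of Schwartz functions. *)
Fixpoint integral_rV (n : nat) : ('rV[R]_n -> R) -> R :=
  match n with
  | 0 => fun F => F 0
  | m.+1 => fun F => \int[lebesgue_measure]_(t in [set: R])
      integral_rV (fun x : 'rV[R]_m => F (row_mx (t%:M : 'M[R]_1) x))
  end.

Definition schwartz_dist phi : dist :=
  fun psi => integral_rV (fun x => phi x * psi x).

(* [f (hermite k)] is <f, h_k>; for [f = schwartz_dist phi] it is the L^2 inner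
   product of [phi] and [h_k]. *)
Definition hs_normsq p f : \bar R :=
  \esum_(k in [set: {ffun 'I_d -> nat}])
    (((2 * \sum_(i < d) k i + d)%N%:R `^ (2 * p)) * f (hermite k) ^+ 2)%:E.

(* The completion of the Schwartz space for the norm of index [p], realised
   inside the tempered distributions: the closure of the Schwartz space in the
   space of tempered distributions of finite norm. *)
Definition hermite_sobolev p : set dist :=
  [set f | [/\ tempered f, (hs_normsq p f < +oo)%E &
    forall e : R, 0 < e ->
      exists phi, (hs_normsq p (f - schwartz_dist phi)%R < e%:E)%E]].

(* Meaningful on [hermite_sobolev p] only: [fine] sends +oo to 0. *)
Definition hs_norm p f : R := Num.sqrt (fine (hs_normsq p f)).

Definition hs_open p : set_system dist := [set A | A `<=` hermite_sobolev p /\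
  forall f, A f -> exists2 e : R, 0 < e & forall g, hermite_sobolev p g ->
    hs_norm p (g - f) < e -> A g].

Definition hs_measurable p (u : 'rV[R]_d -> dist) :=
  (forall x, hermite_sobolev p (u x)) /\
  forall B, <<s hermite_sobolev p, hs_open p>> B ->
    <<s [set A : set 'rV[R]_d | open A]>> (u @^-1` B).

Definition dpartial (i : 'I_d) f : dist := fun phi => - f (spartial i phi).

Definition local_lipschitz p q (F : 'rV[R]_d -> dist -> R) :=
  forall lambda : R, 0 < lambda -> exists C : R, forall x f g,
    hermite_sobolev p f -> hermite_sobolev p g ->
    hs_norm p f < lambda -> hs_norm p g < lambda ->
    `|F x f - F x g| <= C * hs_norm q (f - g).

(* Elements of C([0, T], S_p) are represented by functions on R whose values
   outside [0, T] are irrelevant. *)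
Definition hs_path p (T : R) : set (R -> dist) :=
  [set y | forall t, t \in `[0, T] -> hermite_sobolev p (y t) /\
    hs_norm p (y s - y t) @[s --> within `[0, T] (nbhs t)] --> (0 : R)].

Definition path_norm p (y : R -> dist) (t : R) : R :=
  sup [set hs_norm p (y v) | v in `[0, t]].

(* A simple function on R with values in [dist]: the list of the sets and
   coefficients of the indicator functions it is the sum of. *)
Definition simple := seq (set (measurableTypeR R) * dist).

Definition simple_on q (D : set R) (g : simple) := forall a, a \in g ->
  [/\ measurable a.1, a.1 `<=` D & hermite_sobolev q a.2].

Definition simple_fun (g : simple) (s : R) : dist :=
  \sum_(a <- g) (\1_(a.1) s : R) *: a.2.

Definition simple_integral (g : simple) : dist :=
  \sum_(a <- g) fine (lebesgue_measure a.1) *: a.2.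

(* [v] is the Bochner integral of [F] over [D] in S_q. *)
Definition is_bochner q (D : set R) (F : R -> dist) (v : dist) :=
  [/\ hermite_sobolev q v, forall s, D s -> hermite_sobolev q (F s) &
    exists g : nat -> simple, [/\ forall n, simple_on q D (g n),
      {ae lebesgue_measure, forall s, D s ->
        hs_norm q (F s - simple_fun (g n) s) @[n --> \oo] --> (0 : R)},
      (\int[lebesgue_measure]_(s in D)
        (hs_norm q (F s - simple_fun (g n) s)%R)%:E)%E @[n --> \oo] --> 0%E &
      hs_norm q (v - simple_integral (g n)) @[n --> \oo] --> (0 : R)]].

End distributions.

Section equations.
Context {R : realType} {d : nat}.
Local Notation dist := (schwartz R d -> R^o).
Local Notation mu := (@lebesgue_measure R).
Context (p q T : R).
Context (sigma : 'rV[R]_d -> dist -> 'M[R]_d).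
Context (b : 'rV[R]_d -> dist -> 'rV[R]_d).
Context (c : R -> 'rV[R]_d -> (R -> dist) -> R).
Context (u0 : 'rV[R]_d -> dist).
Implicit Types (x : 'rV[R]_d) (y z : R -> dist) (U : R -> 'rV[R]_d -> dist).

Definition second_order (A : 'M[R]_d) (B : 'rV[R]_d) (f : dist) : dist :=
  2^-1 *: (\sum_(i < d) \sum_(j < d)
    (A *m A^T) i j *: dpartial i (dpartial j f)) -
  \sum_(i < d) B 0 i *: dpartial i f.

Definition opL x (f : dist) : dist := second_order (sigma x f) (b x f) f.

Definition is_hat x y z := hs_path p T z /\ forall t, t \in `[0, T] ->
  z t = expR (- \int[mu]_(s in `[0, t]) c s x z) *: y t.

Definition hat x y : R -> dist := get [set z | is_hat x y z].

Definition opLhat s x y : dist :=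
  second_order (sigma x (hat x y s)) (b x (hat x y s)) (y s) +
  c s x (hat x y) *: y s.

Definition solution_I U := forall x, hs_path p T (U ^~ x) /\
  forall t, t \in `[0, T] ->
    is_bochner q `[0, t] (fun s => opL x (U s x)) (U t x - u0 x).

(* The condition on [is_hat] says that the hat of the path [U ^~ x] is defined,
   as the meaning of [opLhat] requires.  It is not automatic: the conditions
   imposed on [c] allow z' = c(z) z to blow up before time [T]. *)
Definition solution_II U := forall x, [/\ hs_path p T (U ^~ x),
  exists z, is_hat x (U ^~ x) z &
  forall t, t \in `[0, T] ->
    is_bochner q `[0, t] (fun s => opLhat s x (U ^~ x)) (U t x - u0 x)].

Definition uhat U : R -> 'rV[R]_d -> dist :=
  fun t x => expR (\int[mu]_(s in `[0, t]) c s x (U ^~ x)) *: U t x.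

Definition uniquely_solvable (sol : (R -> 'rV[R]_d -> dist) -> Prop) :=
  (exists U, sol U) /\
  forall U V, sol U -> sol V -> forall t x, t \in `[0, T] -> U t x = V t x.

End equations.

(* Main.v *)
(** With a(t) = \int_0^t c(s, x, u) ds, the path e^a u has the path u as its hat,
    and the hat is unique: two hats differ by at most a multiple of the difference
    of their exponents, and the Lipschitz condition on c makes the map from
    exponents to exponents a contraction on short intervals. Hence L-hat along
    e^a u equals e^a L(u) + c e^a u, and the claim is the product rule
    d(e^a u) = e^a du + c e^a u dt for the Bochner integral. Read with -c instead
    of c, the same rule shows that the hat of a solution of (II) solves (I), and
    u is recovered from its hat, so that uniqueness transfers.

    The product rule holds coefficientwise for the Hermite coefficients, which are
    absolutely continuous real functions. It lifts to S_q because the value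
    e^a u - u(0) of the integral is known beforehand: if simple functions h_n
    approximate the integrand in L^1, then Minkowski's inequality bounds the
    distance of that value to the integral of h_n. *)
Require Import Defs.
From HB Require Import structures.
From mathcomp Require Import all_boot all_order all_algebra.
From mathcomp Require Import all_classical all_reals all_analysis.
From mathcomp Require Import finmap measurable_realfun ring lra.

Set Implicit Arguments.
Unset Strict Implicit.
Unset Printing Implicit Defensive.

Import Order.TTheory GRing.Theory Num.Theory.
Import numFieldNormedType.Exports.

Local Open Scope classical_set_scope.
Local Open Scope ring_scope.

(** * Iterated integrals and the space [S_p] *)

(** [S_q] is here a set of functionals with a real-valued [hs_norm], and all its analysis is reduced
    to real functions. The norm is a supremum over finite sets of Hermite coefficients, and each
    coefficient is a bounded functional that turns a Bochner integral into a Lebesgue integral. A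
    coefficient of the integrand of (I) is merely integrable in time, so a path need not be
    differentiable at every point. The product rule is therefore obtained without differentiating:
    the defect between its two sides has increments bounded by K (t - s) (g t - g s), and such a
    function is constant by summation over a fine subdivision. The second obstacle is that the new
    integrand must again be an L^1 limit of simple functions. Sums are harmless; products with a
    scalar function, and the path itself, are treated by one discretisation of mesh 1 / (n + 1).
    Iterated integrals enter because membership in [S_p] asks for approximation by Schwartz
    functions: its stability under linear combinations rests on the linearity of [schwartz_dist]. *)

Section iterated_integral.
Context {R : realType}.
Local Notation mu := (@lebesgue_measure R).

Definition oneDsqr_prodV n (x : 'rV[R]_n) : R :=
  \prod_(i < n) (oneDsqr (x 0 i))^-1.

(** The product majorant survives fixing the first coordinate, so all inner functions of an iterated
    integral stay in this class. Products of two Schwartz functions belong to it. *)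
Definition cauchy_dominated n (C : R) (F : 'rV[R]_n -> R) :=
  continuous (F : 'rV[R]_n -> R^o) /\
  forall x, `|F x| <= C * oneDsqr_prodV x.

Lemma oneDsqr_prodV_gt0 n (x : 'rV[R]_n) : 0 < oneDsqr_prodV x.
Proof. by apply: prodr_gt0 => i _; rewrite invr_gt0 (lt_le_trans ltr01). Qed.

Lemma cauchy_dominated_ge0 n C (F : 'rV[R]_n -> R) :
  cauchy_dominated C F -> 0 <= C.
Proof.
move=> [_ /(_ 0)]; have := oneDsqr_prodV_gt0 (0 : 'rV[R]_n) => h0 h.
by rewrite -(pmulr_lge0 _ h0); exact: le_trans (normr_ge0 _) h.
Qed.

Lemma oneDsqr_prodV_row_mx n t (x : 'rV[R]_n) :
  oneDsqr_prodV (row_mx (t%:M : 'M[R]_1) x) = (oneDsqr t)^-1 * oneDsqr_prodV x.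
Proof.
rewrite /oneDsqr_prodV big_split_ord big_ord1/=; congr (_ * _).
  by rewrite row_mxEl mxE eqxx mulr1n.
by apply: eq_bigr => i _; rewrite row_mxEr.
Qed.

Lemma continuous_row_mxl n (x : 'rV[R]_n) :
  continuous (fun t : R => row_mx (t%:M : 'M[R]_1) x).
Proof.
move=> t; apply/cvg_ballP => e e0; near=> s.
split=> // i j; rewrite /= !mxE; case: splitP => k _.
  rewrite !mxE !ord1 eqxx !mulr1n.
  by near: s; exact: (nbhsx_ballx (t : R^o)).
exact: ballxx.
Unshelve. all: by end_near. Qed.

Lemma continuous_row_mxr n (t : R) :
  continuous (fun x : 'rV[R]_n => row_mx (t%:M : 'M[R]_1) x).
Proof.
move=> x A [P Pn PA]; exists (fun i j => P i (rshift 1 j)) => [i j|y yP].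
  by have := Pn i (rshift 1 j); rewrite row_mxEr.
apply: PA => i j; rewrite -(fintype.splitK j); case: (fintype.split j) => k /=.
  by have := Pn i (lshift n k); rewrite !row_mxEl; exact: nbhs_singleton.
by rewrite row_mxEr; exact: yP.
Qed.

Lemma cauchy_dominated_row_mx n C (F : 'rV[R]_n.+1 -> R) t :
  cauchy_dominated C F ->
  cauchy_dominated (C / oneDsqr t) (fun x : 'rV[R]_n => F (row_mx (t%:M : 'M[R]_1) x)).
Proof.
move=> [cF bF]; split=> [x|x].
  by apply: continuous_comp; [exact: continuous_row_mxr|exact: cF].
by rewrite (le_trans (bF _))// oneDsqr_prodV_row_mx mulrA.
Qed.

Lemma cauchy_dominated_le n C C' (F : 'rV[R]_n -> R) : C <= C' ->
  cauchy_dominated C F -> cauchy_dominated C' F.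
Proof.
move=> CC' [cF bF]; split=> // x; rewrite (le_trans (bF x))//.
by rewrite ler_wpM2r// ltW// oneDsqr_prodV_gt0.
Qed.

Lemma integralT_oneDsqrV :
  (\int[mu]_(x in [set: R]) ((oneDsqr x)^-1)%:E = pi%:E)%E.
Proof.
rewrite ge0_symfun_integralT.
- rewrite [X in integral _ X](_ : _ = `[0, +oo[%classic).
    by rewrite integral0y_oneDsqr -EFinM mulrC divfK.
  by apply/seteqP; split=> x /=; rewrite in_itv/= andbT.
- by move=> x; rewrite invr_ge0 (le_trans ler01).
- exact: continuous_oneDsqrV.
- by move=> x; rewrite /= /oneDsqr sqrrN.
Qed.

Lemma integrable_oneDsqrV (k : R) :
  mu.-integrable setT (fun x => (k * (oneDsqr x)^-1)%:E).
Proof.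
under eq_fun do rewrite EFinM.
apply: integrableZl => //; apply/integrableP; split.
  apply/measurable_EFinP; apply: continuous_measurable_fun.
  exact: continuous_oneDsqrV.
under eq_integral do rewrite gee0_abs ?lee_fin ?invr_ge0 ?(le_trans ler01)//.
by rewrite integralT_oneDsqrV ltry.
Qed.

(** Bound and convergence form a single induction hypothesis: in dimension n + 1 the outer integrand
    must be measurable, which comes from its continuity, that is, from the convergence statement in
    dimension n. Each factor [pi] is the integral of 1 / (1 + t^2) over the line. *)
Definition dominated_integral n :=
  (forall C (F : 'rV[R]_n -> R), cauchy_dominated C F ->
    `|integral_rV F| <= C * pi ^+ n) /\
  (forall C (F_ : nat -> 'rV[R]_n -> R) (F : 'rV[R]_n -> R),
    (forall k, cauchy_dominated C (F_ k)) -> cauchy_dominated C F ->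
    (forall x, F_ k x @[k --> \oo] --> F x) ->
    integral_rV (F_ k) @[k --> \oo] --> integral_rV F).

Definition slice n (F : 'rV[R]_n.+1 -> R) t (x : 'rV[R]_n) :=
  F (row_mx (t%:M : 'M[R]_1) x).

Lemma cauchy_dominated_slice n C (F : 'rV[R]_n.+1 -> R) t :
  cauchy_dominated C F -> cauchy_dominated C (slice F t).
Proof.
move=> dF; apply: cauchy_dominated_le (cauchy_dominated_row_mx t dF).
by rewrite ler_piMr ?(cauchy_dominated_ge0 dF)// oneDsqrV_le1.
Qed.

(** When t_k tends to t, the slices converge pointwise under a common majorant, so the inner
    integral is sequentially continuous in t. Continuity together with the Cauchy bound gives
    integrability. *)
Lemma integral_slice n C (F : 'rV[R]_n.+1 -> R) : dominated_integral n ->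
  cauchy_dominated C F ->
  (forall t, `|integral_rV (slice F t)| <= C * pi ^+ n * (oneDsqr t)^-1) /\
  mu.-integrable setT (fun t => (integral_rV (slice F t))%:E).
Proof.
move=> [IHb IHc] dF.
have Gb t : `|integral_rV (slice F t)| <= C * pi ^+ n * (oneDsqr t)^-1.
  by rewrite mulrAC; exact: IHb (cauchy_dominated_row_mx t dF).
split=> //; apply: le_integrable (integrable_oneDsqrV (C * pi ^+ n)) => //.
  apply/measurable_EFinP; apply: continuous_measurable_fun.
  move=> t; apply/(@cvg_nbhsP _ R^o) => u ut.
  apply: (IHc C) => [k||x]; [exact: cauchy_dominated_slice..|].
  have [cF _] := dF.
  have h := cvg_comp _ _ (@continuous_row_mxl _ x t) (cF _).
  exact: cvg_comp _ _ ut h.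
move=> t _ /=; rewrite lee_fin (le_trans (Gb _))//.
exact: ler_norm.
Qed.

Lemma dominated_integralP n : dominated_integral n.
Proof.
elim: n => [|n IH].
  split=> [C F [_ bF]|C F_ F _ _ cF]; last exact: cF.
  by rewrite expr0 (le_trans (bF _))// /oneDsqr_prodV big_ord0.
have GE F : integral_rV F = \int[mu]_t integral_rV (slice F t) by [].
split=> [C F dF|C F_ F dF_ dF F_F].
  have [Gb Gi] := integral_slice IH dF.
  rewrite GE (le_trans (le_normr_Rintegral _ Gi))//.
  have -> : C * pi ^+ n.+1 = \int[mu]_t (C * pi ^+ n * (oneDsqr t)^-1).
    rewrite /Rintegral; under eq_integral do rewrite EFinM.
    rewrite integralZl//; last first.
      by have := integrable_oneDsqrV 1; under eq_fun do rewrite mul1r.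
    by rewrite integralT_oneDsqrV/= exprSr mulrA.
  apply: le_Rintegral => //; first exact: integrable_norm Gi.
  exact: integrable_oneDsqrV.
have [Gb Gi] := integral_slice IH dF.
have cS t : (integral_rV (slice (F_ k) t))%:E @[k --> \oo] -->
    (integral_rV (slice F t))%:E.
  apply: cvg_EFin; first exact: nearW.
  apply: (proj2 IH C) => [k||x]; [exact: cauchy_dominated_slice..|].
  exact: F_F.
rewrite GE; under eq_fun do rewrite GE.
apply: fine_cvg; rewrite fineK; last exact: integrable_fin_num Gi.
apply: (@dominated_cvg _ _ _ mu _ _ _ _
    (fun t => (C * pi ^+ n * (oneDsqr t)^-1)%:E)) => //.
- by move=> k; apply: measurable_int (proj2 (integral_slice IH (dF_ k))).
- exact: integrable_oneDsqrV.
- by move=> k t _; exact: proj1 (integral_slice IH (dF_ k)) t.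
Qed.

Lemma integral_rV_linear n k C C' (F G : 'rV[R]_n -> R) :
  cauchy_dominated C F -> cauchy_dominated C' G ->
  integral_rV (fun x => k * F x + G x) = k * integral_rV F + integral_rV G.
Proof.
elim: n F G C C' => [//|n IH] F G C C' dF dG /=.
have Gi D H : cauchy_dominated D H -> mu.-integrable setT
    (EFin \o (fun t => integral_rV
      (fun x : 'rV[R]_n => H (row_mx (t%:M : 'M[R]_1) x)))).
  by move=> dH; have [] := integral_slice (dominated_integralP n) dH.
rewrite -RintegralZl//; last exact: Gi dF.
rewrite -RintegralD//; [|exact: integrableZl (Gi _ _ dF)|exact: Gi dG].
apply: eq_Rintegral => t _.
by rewrite (IH _ _ _ _ (cauchy_dominated_row_mx t dF)
  (cauchy_dominated_row_mx t dG)).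
Qed.

End iterated_integral.

Section schwartz_distributions.
Context {R : realType} {d : nat}.
Implicit Types phi psi : schwartz R d.

Lemma schwartz_fun_linear (k : R) phi psi x :
  (k *: phi + psi) x = k * phi x + psi x.
Proof. by []. Qed.

Lemma schwartzP phi : is_schwartz phi.
Proof. by have := schwartz_funP phi => /asboolP. Qed.

(** Expanding the product of the factors 1 + x_i^2 gives the sum, over all subsets [f] of the
    coordinates, of the monomials x^(2f). Rapid decrease of [phi] bounds each of them after
    multiplication by [phi]; of [psi] only boundedness is used. *)
Lemma schwartz_mul_dominated phi psi :
  exists C, cauchy_dominated C (fun x => phi x * psi x).
Proof.
have [sphi rphi] := schwartzP phi; have [spsi rpsi] := schwartzP psi.
have [B hB] := rpsi (fun=> 0%N) [::].
have [C hC] := choice (fun f : {ffun 'I_d -> bool} =>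
  rphi (fun i => 2 * f i)%N [::]).
exists ((\sum_f C f) * B); split=> [x|x].
  have := differentiable_continuous (sphi [::] x).
  have := differentiable_continuous (spsi [::] x) => /= cpsi cphi.
  exact: cvgM cphi cpsi.
rewrite normrM; have B0 : `|psi x| <= B.
  have := hB x; rewrite /= /monomial big1 ?mul1r//.
rewrite mulrAC ler_pM//.
rewrite /oneDsqr_prodV prodfV ler_pdivlMr; last first.
  by apply: prodr_gt0 => i _; rewrite (lt_le_trans ltr01).
rewrite [X in _ * X](_ : _ = \sum_(f : {ffun 'I_d -> bool})
    monomial (fun i => 2 * f i)%N x); last first.
  rewrite /monomial; pose F i (e : bool) := x 0 i ^+ (2 * e).
  rewrite -(bigA_distr_bigA F); apply: eq_bigr => i _.
  by rewrite big_bool/= /F muln0 muln1 expr0 addrC.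
rewrite mulr_sumr ler_sum// => f _.
rewrite (le_trans _ (hC f x))//= normrM mulrC ler_wpM2r//.
exact: ler_norm.
Qed.

Lemma schwartz_dist_linear (k : R) phi psi :
  schwartz_dist (k *: phi + psi) = k *: schwartz_dist phi + schwartz_dist psi.
Proof.
apply/funext => chi; have [C dC] := schwartz_mul_dominated phi chi.
have [C' dC'] := schwartz_mul_dominated psi chi.
rewrite [RHS](_ : _ = k * schwartz_dist phi chi + schwartz_dist psi chi)//.
rewrite /schwartz_dist -(integral_rV_linear _ dC dC'); congr integral_rV.
by apply/funext => x; rewrite schwartz_fun_linear mulrDl mulrA.
Qed.

End schwartz_distributions.

Section tempered_distributions.
Context {R : realType} {d : nat}.
Local Notation dist := (schwartz R d -> R^o).
Implicit Types f g : dist.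

(** This includes empty and unbounded sets, for which [sup] takes its default value 0. *)
Lemma sup_nonneg (S : set R) : (forall x, S x -> 0 <= x) -> 0 <= sup S.
Proof.
move=> S0; have [[[x Sx] ubS]|/sup_out->//] := pselect (has_sup S).
by rewrite (le_trans (S0 _ Sx))// ub_le_sup.
Qed.

Lemma schwartz_seminorm_ge0 a s (phi : schwartz R d) :
  0 <= schwartz_seminorm a s phi.
Proof.
apply: sup_nonneg => _ [x _ <-]; exact: normr_ge0.
Qed.

Lemma tempered_linear (k : R) f g :
  tempered f -> tempered g -> tempered (k *: f + g).
Proof.
move=> [lf [l [C hC]]] [lg [l' [C' hC']]]; split.
  move=> r phi psi.
  rewrite [LHS](_ : _ = k * f (r *: phi + psi) + g (r *: phi + psi))// lf lg.
  rewrite [RHS](_ : _ = r * (k * f phi + g phi) + (k * f psi + g psi))//.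
  by rewrite /GRing.scale/=; ring.
exists (l ++ l'), (`|k| * `|C| + `|C'|) => phi.
have S0 (m : seq (('I_d -> nat) * seq 'I_d)) :
    0 <= \sum_(as_ <- m) schwartz_seminorm as_.1 as_.2 phi.
  by apply: sumr_ge0 => i _; exact: schwartz_seminorm_ge0.
rewrite big_cat/= mulrDl (le_trans (ler_normD _ _))// lerD//.
  rewrite normrZ -mulrA ler_wpM2l// (le_trans (hC _))//.
  rewrite (le_trans (ler_wpM2r (S0 l) (ler_norm C)))//.
  by rewrite ler_wpM2l ?lerDl.
rewrite (le_trans (hC' _))// (le_trans (ler_wpM2r (S0 l') (ler_norm C')))//.
by rewrite ler_wpM2l ?lerDr.
Qed.

Lemma tempered0 : tempered (0 : dist).
Proof.
split=> [r phi psi|]; first by rewrite ![(0 : dist) _]/(0 : R) scaler0 addr0.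
by exists [::], 0 => phi; rewrite normr0 mul0r.
Qed.

End tempered_distributions.

(** * Norm estimates from finitely many Hermite coefficients *)

Section hermite_sobolev_norm.
Context {R : realType} {d : nat}.
Local Notation dist := (schwartz R d -> R^o).
Local Notation idx := {ffun 'I_d -> nat}.
Implicit Types (f g : dist) (p q : R) (X : {fset idx}).

Definition hs_weight p (k : idx) : R := (2 * \sum_(i < d) k i + d)%N%:R `^ (2 * p).

(** The partial sum of the inner product over a finite set of multi-indices. It is bilinear without
    any convergence condition, and [hs_normsq] is the supremum of its diagonal values. *)
Definition hs_inner p X f g : R :=
  \sum_(k <- X) hs_weight p k * (f (hermite k) * g (hermite k)).

Lemma hs_weight_ge0 p k : 0 <= hs_weight p k.
Proof. exact: powR_ge0. Qed.

Lemma hs_inner_ge0 p X f : 0 <= hs_inner p X f f.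
Proof. by apply: sumr_ge0 => k _; rewrite mulr_ge0 ?hs_weight_ge0// -expr2 sqr_ge0. Qed.

Lemma hs_normsq_ge0 p f : (0 <= hs_normsq p f)%E.
Proof.
by apply: esum_ge0 => k _; rewrite lee_fin mulr_ge0 ?hs_weight_ge0// sqr_ge0.
Qed.

Lemma hs_normsqP p f (M : R) :
  (hs_normsq p f <= M%:E)%E <-> forall X, hs_inner p X f f <= M.
Proof.
split=> [h X|h].
  rewrite -lee_fin (le_trans _ h)//; apply: esum_ge.
  exists [set` X]; first by split.
  rewrite fsbig_finite//= set_fsetK /hs_inner -sumEFin.
  by apply: lee_sum => k _; rewrite -expr2.
apply: ge_ereal_sup => _ [A [fA _] <-].
rewrite fsbig_finite//= sumEFin lee_fin; exact: h.
Qed.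

Lemma hs_norm_ge0 p f : 0 <= hs_norm p f.
Proof. exact: sqrtr_ge0. Qed.

Lemma hs_normsqE p f : (hs_normsq p f < +oo)%E ->
  hs_normsq p f = (hs_norm p f ^+ 2)%:E.
Proof.
move=> h; rewrite /hs_norm sqr_sqrtr ?fine_ge0 ?hs_normsq_ge0//.
by rewrite fineK// ge0_fin_numE// hs_normsq_ge0.
Qed.

Lemma hs_inner_le p f X : (hs_normsq p f < +oo)%E ->
  hs_inner p X f f <= hs_norm p f ^+ 2.
Proof. by move=> h; apply: (proj1 (hs_normsqP p f _)); rewrite hs_normsqE. Qed.

(** Finiteness is delivered together with the bound, since [hs_norm] is 0 where [hs_normsq] is
    infinite and an estimate of it alone would say nothing. *)
Lemma hs_norm_le p f (M : R) : 0 <= M ->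
  (forall X, hs_inner p X f f <= M ^+ 2) ->
  (hs_normsq p f < +oo)%E /\ hs_norm p f <= M.
Proof.
move=> M0 /hs_normsqP h.
have fin : (hs_normsq p f < +oo)%E by rewrite (le_lt_trans h)// ltry.
split=> //; rewrite -(@ler_pXn2r _ 2)// ?nnegrE ?hs_norm_ge0//.
by rewrite -lee_fin -hs_normsqE.
Qed.

Lemma hs_inner_lin p X (k : R) f g h :
  hs_inner p X (k *: f + g) h = k * hs_inner p X f h + hs_inner p X g h.
Proof.
rewrite /hs_inner mulr_sumr -big_split/=; apply: eq_bigr => i _.
rewrite [(k *: f + g) _](_ : _ = k * f (hermite i) + g (hermite i))//; ring.
Qed.

Lemma hs_inner0 p X f : hs_inner p X 0 f = 0.
Proof. by rewrite /hs_inner big1// => i _; rewrite mul0r mulr0. Qed.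

Lemma hs_innerZ p X (k : R) f g : hs_inner p X (k *: f) g = k * hs_inner p X f g.
Proof. by rewrite -[k *: f]addr0 hs_inner_lin hs_inner0 addr0. Qed.

Lemma hs_innerC p X f g : hs_inner p X f g = hs_inner p X g f.
Proof. by apply: eq_bigr => i _; rewrite (mulrC (f _)). Qed.

Lemma hs_inner_sq p X (k : R) f g : hs_inner p X (k *: f + g) (k *: f + g) =
  k ^+ 2 * hs_inner p X f f + 2 * k * hs_inner p X f g + hs_inner p X g g.
Proof.
rewrite hs_inner_lin (hs_innerC _ _ f) (hs_innerC _ _ g) !hs_inner_lin.
by rewrite (hs_innerC _ _ g f); ring.
Qed.

(** The quadratic polynomial in r that bounds the square of r f + g is nonnegative. Evaluating it at
    a suitable r gives the claim; the degenerate cases a = 0 and b = 0 need their own values of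
    r. *)
Lemma hs_inner_CS p X f g (a b : R) : 0 <= a -> 0 <= b ->
  hs_inner p X f f <= a ^+ 2 -> hs_inner p X g g <= b ^+ 2 ->
  hs_inner p X f g <= a * b.
Proof.
move=> a0 b0 fa gb.
have key (r : R) : 0 <= r ^+ 2 * a ^+ 2 + 2 * r * hs_inner p X f g + b ^+ 2.
  have := hs_inner_ge0 p X (r *: f + g).
  rewrite hs_inner_sq.
  have := ler_wpM2l (sqr_ge0 r) fa; lra.
move: {fa gb}(hs_inner p X f g) key => I key.
have [//|I0] := leP I 0; first by move=> /le_trans; apply; rewrite mulr_ge0.
have [a0'|a1] := leP a 0.
  have aE : a = 0 by apply/le_anti/andP.
  (* With a = 0 the polynomial is affine in r, and this r gives it the value -1. *)
  have := key (- ((b ^+ 2 + 1) / (2 * I))).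
  rewrite aE expr0n/= mulr0 add0r.
  rewrite (_ : 2 * _ * I = - (b ^+ 2 + 1)); last by field; rewrite gt_eqF.
  lra.
have [b0'|b1] := leP b 0.
  have bE : b = 0 by apply/le_anti/andP.
  have a21 : 0 < a ^+ 2 + 1 by rewrite ltr_wpDl// sqr_ge0.
  (* With b = 0 and e = I / (a^2 + 1), the value at -e is - e (I + e), which is negative. *)
  have := key (- (I / (a ^+ 2 + 1))).
  rewrite bE expr0n/= addr0; set e := I / _.
  have eI : I = e * (a ^+ 2 + 1) by rewrite /e divfK// gt_eqF.
  have e0 : 0 < e by rewrite divr_gt0.
  rewrite sqrrN (_ : _ + _ = - (e * (I + e))); last by rewrite eI; ring.
  by rewrite oppr_ge0 pmulr_rle0//; lra.
(* At r = - b / a both square terms equal b^2, which leaves I (b / a) <= b^2. *)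
have := key (- (b / a)).
rewrite sqrrN expr_div_n divfK ?expf_eq0 ?gt_eqF// => h.
suff : I * (b / a) <= (a * b) * (b / a) by rewrite ler_pM2r// divr_gt0.
rewrite (_ : a * b * (b / a) = b ^+ 2); [lra|field; rewrite gt_eqF//].
Qed.

Lemma hs_normD p f g : (hs_normsq p f < +oo)%E -> (hs_normsq p g < +oo)%E ->
  (hs_normsq p (f + g)%R < +oo)%E /\ hs_norm p (f + g) <= hs_norm p f + hs_norm p g.
Proof.
move=> nf ng; apply: hs_norm_le => [|X]; first by rewrite addr_ge0 ?hs_norm_ge0.
rewrite -[f in f + g]scale1r hs_inner_sq.
have := hs_inner_le X nf; have := hs_inner_le X ng.
have := hs_inner_CS (hs_norm_ge0 p f) (hs_norm_ge0 p g) (hs_inner_le X nf)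
  (hs_inner_le X ng).
lra.
Qed.

Lemma hs_normZ_le p (k : R) f : (hs_normsq p f < +oo)%E ->
  (hs_normsq p (k *: f)%R < +oo)%E /\ hs_norm p (k *: f) <= `|k| * hs_norm p f.
Proof.
move=> nf; apply: hs_norm_le => [|X]; first by rewrite mulr_ge0 ?hs_norm_ge0.
rewrite hs_innerZ hs_innerC hs_innerZ mulrA -expr2.
by rewrite exprMn real_normK ?num_real// ler_wpM2l ?sqr_ge0// hs_inner_le.
Qed.

Lemma hs_norm0 p : (hs_normsq p (0 : dist)%R < +oo)%E /\ hs_norm p (0 : dist) = 0.
Proof.
have [|X|fin n0] := @hs_norm_le p (0 : dist) 0 => //.
  by rewrite hs_inner0 sqr_ge0.
by split=> //; apply/le_anti; rewrite n0 hs_norm_ge0.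
Qed.

(** The single term of index [k] is already bounded by the squared norm. Since [0 < d], the base
    2|k| + d is at least 1 and the weight can be divided out. *)
Lemma hs_coef_le p k : exists2 C : R, 0 <= C & forall f, (hs_normsq p f < +oo)%E ->
  (0 < d)%N -> `|f (hermite k)| <= C * hs_norm p f.
Proof.
exists (Num.sqrt (hs_weight p k))^-1 => [|f nf d0]; first by rewrite invr_ge0 sqrtr_ge0.
have w0 : 0 < hs_weight p k by rewrite powR_gt0// ltr0n addn_gt0 d0 orbT.
have := hs_inner_le [fset k]%fset nf; rewrite /hs_inner big_seq_fset1 -expr2 => h.
rewrite ler_pdivlMl ?sqrtr_gt0// -(@ler_pXn2r _ 2)// ?nnegrE ?hs_norm_ge0//.
by rewrite exprMn sqr_sqrtr ?hs_weight_ge0// real_normK ?num_real.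
Qed.

Lemma hs_norm_mono p q f : (0 < d)%N -> q <= p -> (hs_normsq p f < +oo)%E ->
  (hs_normsq q f < +oo)%E /\ hs_norm q f <= hs_norm p f.
Proof.
move=> d0 qp nf; apply: hs_norm_le => [|X]; first exact: hs_norm_ge0.
rewrite (le_trans _ (hs_inner_le X nf))// ler_sum// => k _.
rewrite ler_wpM2r -?expr2 ?sqr_ge0// ler_powR ?ler_wpM2l//.
by rewrite ler1n addn_gt0 d0 orbT.
Qed.

Lemma hermite_sobolev_linear p (k : R) f g :
  hermite_sobolev p f -> hermite_sobolev p g -> hermite_sobolev p (k *: f + g).
Proof.
move=> [tf nf af] [tg ng ag].
have [nkf _] := hs_normZ_le k nf; have [nkfg _] := hs_normD nkf ng.
split=> //; first exact: tempered_linear.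
move=> e e0.
(* Chosen so that k^2 e1 <= e / 4: the square of |k| F + G is at most 2 k^2 F^2 + 2 G^2, and each of
   the two terms is to cost at most e / 2. The summand 1 covers k = 0. *)
pose e1 := e / (4 * (k ^+ 2 + 1)).
have k1 : 0 < k ^+ 2 + 1 by rewrite ltr_wpDl// sqr_ge0.
have e10 : 0 < e1 by rewrite divr_gt0// mulr_gt0.
have [phi hphi] := af e1 e10; have [psi hpsi] := ag (e / 4) ltac:(lra).
exists (k *: phi + psi); rewrite schwartz_dist_linear.
set F := f - schwartz_dist phi in hphi; set G := g - schwartz_dist psi in hpsi.
rewrite (_ : _ - _ = k *: F + G); last first.
  by rewrite /F /G scalerBr opprD addrACA.
have nF : (hs_normsq p F < +oo)%E by rewrite (lt_trans hphi)// ltry.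
have nG : (hs_normsq p G < +oo)%E by rewrite (lt_trans hpsi)// ltry.
have [nkF bkF] := hs_normZ_le k nF; have [nkFG bkFG] := hs_normD nkF nG.
rewrite (hs_normsqE nF) lte_fin in hphi.
rewrite (hs_normsqE nG) lte_fin in hpsi.
rewrite (hs_normsqE nkFG) lte_fin.
have b : hs_norm p (k *: F + G) <= `|k| * hs_norm p F + hs_norm p G.
  by rewrite (le_trans bkFG)// lerD2r.
have F0 := hs_norm_ge0 p F; have G0 := hs_norm_ge0 p G.
have H0 := hs_norm_ge0 p (k *: F + G).
rewrite (@le_lt_trans _ _ ((`|k| * hs_norm p F + hs_norm p G) ^+ 2))//.
  by rewrite ler_pXn2r ?nnegrE// addr_ge0// mulr_ge0.
rewrite (@le_lt_trans _ _ (2 * (k ^+ 2 * hs_norm p F ^+ 2) + 2 * hs_norm p G ^+ 2))//.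
  rewrite -[k ^+ 2]real_normK ?num_real//.
  have := sqr_ge0 (`|k| * hs_norm p F - hs_norm p G); lra.
have : k ^+ 2 * hs_norm p F ^+ 2 <= e / 4.
  rewrite (@le_trans _ _ (k ^+ 2 * e1))// ?ler_wpM2l ?sqr_ge0 ?ltW//.
  rewrite (_ : k ^+ 2 * e1 = e / 4 - e1); first lra.
  by rewrite /e1; field; rewrite gt_eqF.
lra.
Qed.

Lemma hermite_sobolev_finite p f : hermite_sobolev p f -> (hs_normsq p f < +oo)%E.
Proof. by case. Qed.

Lemma hermite_sobolev_mono p q : (0 < d)%N -> q <= p ->
  hermite_sobolev p `<=` @hermite_sobolev R d q.
Proof.
move=> d0 qp f [tf nf af]; have [nqf _] := hs_norm_mono d0 qp nf.
split=> // e /af[phi H]; exists phi.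
have nh : (hs_normsq p (f - schwartz_dist phi)%R < +oo)%E by rewrite (lt_trans H)// ltry.
have [nqh le] := hs_norm_mono d0 qp nh.
rewrite (hs_normsqE nqh); move: H; rewrite (hs_normsqE nh) !lte_fin.
apply: le_lt_trans.
by rewrite ler_pXn2r ?nnegrE ?hs_norm_ge0.
Qed.

Lemma hermite_sobolev0 p : hermite_sobolev p (0 : dist).
Proof.
have [n0 nE] := hs_norm0 p; split=> //; first exact: tempered0.
move=> e e0; exists 0.
have -> : schwartz_dist (0 : schwartz R d) = 0.
  by have := schwartz_dist_linear (-1) (0 : schwartz R d) 0;
    rewrite scaler0 addr0 scaleN1r addNr.
by rewrite subr0 (hs_normsqE n0) nE expr0n/= lte_fin.
Qed.

End hermite_sobolev_norm.

(** * The product rule for absolutely continuous functions *)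

Section bounded_integrands.
Context {dT : measure_display} {T : measurableType dT} {R : realType}.
Context {mu : {measure set T -> \bar R}}.

Lemma measurable_normr_le_integrable (D : set T) (f : T -> R) (M : R) : measurable D ->
  (mu D < +oo)%E -> measurable_fun D f -> (forall r, D r -> `|f r| <= M) ->
  mu.-integrable D (EFin \o f).
Proof.
move=> mD fD mf fM; apply: measurable_bounded_integrable => //.
exists M; split; first exact: num_real.
by move=> N MN r Dr /=; exact: le_trans (fM _ Dr) (ltW MN).
Qed.

Lemma integrable_bounded_mul (D : set T) (f g : T -> R) (M : R) : measurable D ->
  measurable_fun D f -> (forall r, D r -> `|f r| <= M) ->
  mu.-integrable D (EFin \o g) -> mu.-integrable D (EFin \o (fun r => f r * g r)).
Proof.
move=> mD mf fM ig.
have mg : measurable_fun D g by apply/measurable_EFinP; exact: measurable_int ig.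
apply: le_integrable (integrableZl mD M (integrable_norm ig)) => //.
  by apply/measurable_EFinP; exact: measurable_funM.
move=> r Dr; rewrite [leRHS](_ : _ = `|M * `|g r| |%:E)// lee_fin !normrM normr_id ler_wpM2r//.
by rewrite (le_trans (fM _ Dr))// ler_norm.
Qed.

Lemma normr_Rintegral_mul_le (D : set T) (f g : T -> R) (M : R) : measurable D ->
  measurable_fun D f -> (forall r, D r -> `|f r| <= M) ->
  mu.-integrable D (EFin \o g) ->
  `|\int[mu]_(r in D) (f r * g r)| <= M * \int[mu]_(r in D) `|g r|.
Proof.
move=> mD mf fM ig; have ifg := integrable_bounded_mul mD mf fM ig.
rewrite (le_trans (le_normr_Rintegral mD ifg))// -RintegralZl//; last exact: integrable_norm.
apply: le_Rintegral => //; first exact: integrable_norm.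
  exact: integrableZl mD M _ (integrable_norm ig).
by move=> r Dr; rewrite normrM ler_wpM2r// fM.
Qed.

End bounded_integrands.

(** * Primitives, their exponentials and the scalar product rule *)

Section scalar_integrals.
Context {R : realType}.
Local Notation mu := (@lebesgue_measure R).
Implicit Types (f g : R -> R) (s t T K M : R).

(* Telescoping over n equal steps bounds [f T - f 0] by [K * T / n * (g T - g 0)]. *)
Lemma eq_of_superlinear_increments f g T K : 0 <= T ->
  (forall s t, 0 <= s -> s <= t -> t <= T ->
    `|f t - f s| <= K * (t - s) * (g t - g s)) ->
  f T = f 0.
Proof.
move=> T0 fg; apply/eqP; rewrite -subr_eq0 -normr_le0.
apply/ler_addgt0Pl => e e0; rewrite addr0.
set L := K * T * (g T - g 0).
pose n := (Num.truncn (`|L| / e)).+1.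
have n0 : 0 < n%:R :> R by rewrite ltr0n.
have nL : `|L| / n%:R <= e.
  rewrite ler_pdivrMr// mulrC -ler_pdivrMr//.
  by rewrite ltW// truncnS_gt.
pose u (j : nat) := T * (j%:R / n%:R).
have uS j : u j.+1 - u j = T / n%:R.
  by rewrite /u -mulrBr -mulrBl -natrB// subSnn mulrA mulr1.
have step j : (j <= n)%N -> `|f (u j) - f 0| <= K * (T / n%:R) * (g (u j) - g 0).
  elim: j => [_|j IH jn]; first by rewrite /u !(mul0r, mulr0) !subrr normr0 mulr0.
  rewrite -[f _ - f 0](subrKA (f (u j))) (le_trans (ler_normD _ _))//.
  rewrite -[g _ - g 0](subrKA (g (u j))) mulrDr lerD//; last exact: IH (ltnW jn).
  rewrite -(uS j); apply: fg.
  - by rewrite /u mulr_ge0// divr_ge0.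
  - by rewrite -subr_ge0 (uS j) divr_ge0.
  - by rewrite /u ler_piMr// ler_pdivrMr// mul1r ler_nat.
have := step n (leqnn _); rewrite /u divff ?gt_eqF// mulr1.
move=> /le_trans; apply; rewrite (le_trans _ nL)//.
rewrite [leLHS](_ : _ = L / n%:R) ?ler_wpM2r ?invr_ge0 ?ler_norm//.
by rewrite /L; ring.
Qed.

Lemma lebesgue_itv_oc s t : s <= t -> fine (mu `]s, t]) = t - s.
Proof. by move=> st; rewrite lebesgue_measure_itv/= lte_fin; case: ltP => //= ts; lra. Qed.

Lemma lebesgue_itv_lty (a b : bool) s t :
  (mu [set` Interval (BSide a s) (BSide b t)] < +oo)%E.
Proof. by rewrite lebesgue_measure_itv/=; case: ifP => _; rewrite -?EFinD ltry. Qed.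

Lemma subitv_oc s t T : 0 <= s -> t <= T -> `]s, t] `<=` `[0, T].
Proof.
move=> s0 tT r /=; rewrite !in_itv/= => /andP[sr rt].
by rewrite (le_trans s0 (ltW sr)) (le_trans rt tT).
Qed.

Lemma subitv_cc t T : t <= T -> `[0, t] `<=` `[0, T].
Proof.
move=> tT r /=; rewrite !in_itv/= => /andP[-> rt].
by rewrite (le_trans rt tT).
Qed.

Lemma integrable_oc f s t T : 0 <= s -> t <= T ->
  mu.-integrable `[0, T] (EFin \o f) -> mu.-integrable `]s, t] (EFin \o f).
Proof. by move=> s0 tT; apply: integrableS => //; exact: subitv_oc. Qed.

Lemma integrable_itv_mul f g T M : measurable_fun `[0, T] f ->
  (forall r, r \in `[0, T] -> `|f r| <= M) ->
  mu.-integrable `[0, T] (EFin \o g) ->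
  mu.-integrable `[0, T] (EFin \o (fun r => f r * g r)).
Proof. by move=> mf fM; exact: (@integrable_bounded_mul _ _ _ mu _ f g M). Qed.

Lemma Rintegral_sub f s t T : 0 <= s -> s <= t -> t <= T ->
  mu.-integrable `[0, T] (EFin \o f) ->
  \int[mu]_(r in `[0, t]) f r - \int[mu]_(r in `[0, s]) f r =
  \int[mu]_(r in `]s, t]) f r.
Proof.
move=> s0 st tT f_int; rewrite Rintegral_itvB ?bnd_simp//.
by apply: integrableS f_int => //; exact: subitv_cc.
Qed.

Lemma Rintegral_sub_norm_le f s t T : 0 <= s -> s <= t -> t <= T ->
  mu.-integrable `[0, T] (EFin \o f) ->
  `|\int[mu]_(r in `[0, t]) f r - \int[mu]_(r in `[0, s]) f r| <=
  \int[mu]_(r in `]s, t]) `|f r|.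
Proof.
move=> s0 st tT f_int; rewrite (Rintegral_sub s0 st tT f_int).
apply: le_normr_Rintegral => //.
by apply: integrableS f_int => //; exact: subitv_oc.
Qed.

Lemma Rintegral_sub_bounded f s t T M : 0 <= s -> s <= t -> t <= T ->
  measurable_fun `[0, T] f -> (forall r, r \in `[0, T] -> `|f r| <= M) ->
  `|\int[mu]_(r in `[0, t]) f r - \int[mu]_(r in `[0, s]) f r| <= M * (t - s).
Proof.
move=> s0 st tT mf fM.
have f_int : mu.-integrable `[0, T] (EFin \o f).
  apply: (@measurable_normr_le_integrable _ _ _ mu _ f M) => //.
  exact: lebesgue_itv_lty.
rewrite (le_trans (Rintegral_sub_norm_le s0 st tT f_int))//.
rewrite -lebesgue_itv_oc// -Rintegral_cst//.
have sub := subitv_oc s0 tT.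
apply: le_Rintegral => //.
- by apply: integrable_norm; exact: integrableS f_int.
- apply: (@measurable_normr_le_integrable _ _ _ mu _ (cst M) `|M|) => //.
  exact: lebesgue_itv_lty.
- by move=> r /sub; exact: fM.
Qed.

Lemma measurable_Rintegral_itv f T : 0 <= T -> mu.-integrable `[0, T] (EFin \o f) ->
  measurable_fun `[0, T] (fun t => \int[mu]_(r in `[0, t]) f r).
Proof.
move=> T0 f_int; apply: subspace_continuous_measurable_fun => //.
exact: parameterized_integral_continuous.
Qed.

Lemma normr_Rintegral_itv_le f t T : 0 <= t -> t <= T ->
  mu.-integrable `[0, T] (EFin \o f) ->
  `|\int[mu]_(r in `[0, t]) f r| <= \int[mu]_(r in `[0, T]) `|f r|.
Proof.
move=> t0 tT f_int.
have ft_int : mu.-integrable `[0, t] (EFin \o f).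
  by apply: integrableS f_int => //; exact: subitv_cc.
rewrite (le_trans (le_normr_Rintegral _ ft_int))// -subr_ge0.
rewrite (Rintegral_sub t0 tT (lexx T) (integrable_norm f_int)).
by apply: Rintegral_ge0 => r _; exact: normr_ge0.
Qed.

(** [A] is Lipschitz and [W] absolutely continuous. The defect [h] of the formula has increments of
    order (t - s) times the increment of the primitive [om] of |w|, so
    [eq_of_superlinear_increments] makes it constant. *)
Lemma integration_by_parts_bounded (A W a w : R -> R) (M T : R) : 0 <= T ->
  measurable_fun `[0, T] a -> (forall r, r \in `[0, T] -> `|a r| <= M) ->
  mu.-integrable `[0, T] (EFin \o w) ->
  (forall t, t \in `[0, T] -> A t = A 0 + \int[mu]_(r in `[0, t]) a r) ->
  (forall t, t \in `[0, T] -> W t = W 0 + \int[mu]_(r in `[0, t]) w r) ->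
  [/\ mu.-integrable `[0, T] (EFin \o (fun r => A r * w r)),
      mu.-integrable `[0, T] (EFin \o (fun r => a r * W r)) &
      A T * W T = A 0 * W 0 + \int[mu]_(r in `[0, T]) (A r * w r + a r * W r)].
Proof.
move=> T0 ma aM iw AE WE.
have M0 : 0 <= M by rewrite (le_trans _ (aM 0 _)) ?in_itv/= ?lexx.
have ia : mu.-integrable `[0, T] (EFin \o a).
  apply: (@measurable_normr_le_integrable _ _ _ mu _ a M) => //.
  exact: lebesgue_itv_lty.
have mprim F f : mu.-integrable `[0, T] (EFin \o f) ->
    (forall t, t \in `[0, T] -> F t = F 0 + \int[mu]_(r in `[0, t]) f r) ->
    measurable_fun `[0, T] F.
  move=> f_int FE; apply: (eq_measurable_fun (fun t => F 0 + \int[mu]_(r in `[0, t]) f r)).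
    by move=> t /set_mem tT; rewrite (FE t tT).
  by apply: measurable_funD => //; exact: measurable_Rintegral_itv.
have bprim F f : mu.-integrable `[0, T] (EFin \o f) ->
    (forall t, t \in `[0, T] -> F t = F 0 + \int[mu]_(r in `[0, t]) f r) ->
    forall t, t \in `[0, T] -> `|F t| <= `|F 0| + \int[mu]_(r in `[0, T]) `|f r|.
  move=> f_int FE t t0T; rewrite FE// (le_trans (ler_normD _ _))// lerD2l.
  by move: t0T; rewrite in_itv/= => /andP[? ?]; exact: normr_Rintegral_itv_le.
have iAw : mu.-integrable `[0, T] (EFin \o (fun r => A r * w r)).
  exact: integrable_itv_mul (mprim _ _ ia AE) (bprim _ _ ia AE) iw.
have iWa : mu.-integrable `[0, T] (EFin \o (fun r => a r * W r)).
  have := integrable_itv_mul (mprim _ _ iw WE) (bprim _ _ iw WE) ia.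
  rewrite (_ : (fun _ => _ * _) = (fun r => a r * W r))//.
  by apply/funext => r; rewrite mulrC.
have iS : mu.-integrable `[0, T] (EFin \o (fun r => A r * w r + a r * W r)).
  by apply: (@integrableD _ _ _ mu _ _ _ _ iAw iWa); exact: measurable_itv.
split=> //.
pose h t := A t * W t - \int[mu]_(r in `[0, t]) (A r * w r + a r * W r).
pose om t := \int[mu]_(r in `[0, t]) `|w r|.
have in0T t : 0 <= t -> t <= T -> t \in `[0, T] by move=> t0 tT; rewrite in_itv/= t0.
suff hT : h T = h 0.
  have h0 : h 0 = A 0 * W 0 by rewrite /h set_itv1 Rintegral_set1 subr0.
  by rewrite -h0 -hT /h subrK.
apply: (@eq_of_superlinear_increments h om T (M + M)) => // s t s0 st tT.
have t0 := le_trans s0 st; have sT := le_trans st tT.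
have sub := subitv_oc s0 tT.
have omE : om t - om s = \int[mu]_(r in `]s, t]) `|w r|.
  by rewrite /om (Rintegral_sub s0 st tT)//; exact: integrable_norm.
have iSst := integrable_oc s0 tT iS.
have iwst := integrable_oc s0 tT iw.
have iast := integrable_oc s0 tT ia.
have AB r : s <= r -> r <= t -> `|A s - A r| <= M * (t - s).
  move=> sr rt; rewrite distrC AE ?in0T ?(le_trans s0)// ?(le_trans rt)//.
  rewrite (AE s) ?in0T// opprD addrACA subrr add0r.
  rewrite (le_trans (Rintegral_sub_bounded s0 sr (le_trans rt tT) ma aM))//.
  by rewrite ler_wpM2l// lerD2r.
have WB r : s <= r -> r <= t -> `|W t - W r| <= om t - om s.
  move=> sr rt; have r0 := le_trans s0 sr; have rT := le_trans rt tT.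
  rewrite WE ?in0T// (WE r) ?in0T// opprD addrACA subrr add0r.
  rewrite (le_trans (Rintegral_sub_norm_le r0 rt tT iw))//.
  rewrite -(Rintegral_sub r0 rt tT (integrable_norm iw)) lerD2l lerN2.
  rewrite -subr_ge0 (Rintegral_sub s0 sr rT (integrable_norm iw)).
  by apply: Rintegral_ge0 => x _; exact: normr_ge0.
(* [A] is frozen at the left end and [W] at the right end, since A t W t - A s W s = A s (W t - W s)
   + W t (A t - A s) holds exactly, with no product of two increments left over. *)
have -> : h t - h s =
    \int[mu]_(r in `]s, t]) ((A s - A r) * w r) +
    \int[mu]_(r in `]s, t]) ((W t - W r) * a r).
  have iAs : mu.-integrable `]s, t] (EFin \o (fun r => A s * w r)).
    by apply: (@integrableZl _ _ _ mu _ _ _ _ iwst); exact: measurable_itv.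
  have iWt : mu.-integrable `]s, t] (EFin \o (fun r => W t * a r)).
    by apply: (@integrableZl _ _ _ mu _ _ _ _ iast); exact: measurable_itv.
  have iAwst := integrable_oc s0 tT iAw.
  have iWast := integrable_oc s0 tT iWa.
  have -> : \int[mu]_(r in `]s, t]) ((A s - A r) * w r) =
      A s * \int[mu]_(r in `]s, t]) w r - \int[mu]_(r in `]s, t]) (A r * w r).
    by rewrite -RintegralZl// -RintegralB//; apply: eq_Rintegral => r _; rewrite mulrBl.
  have -> : \int[mu]_(r in `]s, t]) ((W t - W r) * a r) =
      W t * \int[mu]_(r in `]s, t]) a r - \int[mu]_(r in `]s, t]) (a r * W r).
    rewrite -RintegralZl// -RintegralB//; apply: eq_Rintegral => r _.
    by rewrite mulrBl (mulrC (W r)).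
  rewrite -(Rintegral_sub s0 st tT iw) -(Rintegral_sub s0 st tT ia).
  have -> : h t - h s = A t * W t - A s * W s -
    (\int[mu]_(r in `]s, t]) (A r * w r) + \int[mu]_(r in `]s, t]) (a r * W r)).
    by rewrite -RintegralD// -(Rintegral_sub s0 st tT iS) /h; ring.
  have WEt := WE t (in0T _ t0 tT); have WEs := WE s (in0T _ s0 sT).
  have AEt := AE t (in0T _ t0 tT); have AEs := AE s (in0T _ s0 sT).
  move: (\int[mu]_(r in `[0, t]) w r) (\int[mu]_(r in `[0, s]) w r)
    WEt WEs => x1 x2 WEt WEs.
  move: (\int[mu]_(r in `[0, t]) a r) (\int[mu]_(r in `[0, s]) a r)
    AEt AEs => y1 y2 AEt AEs.
  rewrite WEt WEs AEt AEs; ring.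
rewrite (le_trans (ler_normD _ _))// -mulrA mulrDl lerD//.
  have := @normr_Rintegral_mul_le _ _ _ mu `]s, t] (fun r => A s - A r) w (M * (t - s)).
  rewrite omE mulrA; apply => //.
    apply: measurable_funB => //.
    by apply: measurable_funS (mprim _ _ ia AE).
  by move=> r /=; rewrite in_itv/= => /andP[/ltW sr rt]; exact: AB.
have := @normr_Rintegral_mul_le _ _ _ mu `]s, t] (fun r => W t - W r) a (om t - om s).
have -> : M * ((t - s) * (om t - om s)) = (om t - om s) * (M * (t - s)) by ring.
move=> h1; rewrite (le_trans (h1 _ _ _ _))//.
- apply: measurable_funB => //.
  by apply: measurable_funS (mprim _ _ iw WE).
- by move=> r /=; rewrite in_itv/= => /andP[/ltW sr rt]; exact: WB.
- apply: ler_wpM2l; first by rewrite omE; apply: Rintegral_ge0 => x _; exact: normr_ge0.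
  rewrite -lebesgue_itv_oc// -Rintegral_cst//; apply: le_Rintegral => //.
  + exact: integrable_norm.
  + apply: (@measurable_normr_le_integrable _ _ _ mu _ (cst M) `|M|) => //.
    exact: lebesgue_itv_lty.
  + by move=> r /sub; exact: aM.
Qed.

(** Both estimates come from the tangent inequality [lo], used in both directions: it places the
    Taylor remainder between 0 and (e^x - e^y) (x - y), and the first estimate bounds that
    product. *)
Lemma expR_increment (x y B : R) : `|x| <= B -> `|y| <= B ->
  `|expR x - expR y| <= expR B * `|x - y| /\
  `|expR x - expR y - expR y * (x - y)| <= expR B * `|x - y| ^+ 2.
Proof.
move=> /ler_normlP[_ xB] /ler_normlP[_ yB].
have lo (u v : R) : expR v * (u - v) <= expR u - expR v.
  have -> : expR u = expR v * expR (u - v) by rewrite -expRD addrC subrK.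
  rewrite -[in leRHS](mulr1 (expR v)) -mulrA -mulrBr mul1r ler_wpM2l ?expR_ge0//.
  by have := expR_ge1Dx (u - v); lra.
have lip : `|expR x - expR y| <= expR B * `|x - y|.
  have ex : expR x <= expR B by rewrite ler_expR.
  have ey : expR y <= expR B by rewrite ler_expR.
  have := lo x y; have := lo y x; have := expR_gt0 x; have := expR_gt0 y.
  have [xy|xy] := leP y x.
    by rewrite !ger0_norm ?subr_ge0 ?ler_expR//; nra.
  by rewrite !ltr0_norm ?subr_lt0 ?ltr_expR//; nra.
split=> //; rewrite ger0_norm; last by have := lo x y; lra.
have := lo y x => h.
rewrite (@le_trans _ _ ((expR x - expR y) * (x - y)))//; first lra.
by rewrite (le_trans (ler_norm _))// normrM expr2 mulrA ler_wpM2r.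
Qed.

(** The chain rule for an exponent [a] that is only Lipschitz, again through a defect [h] whose
    increments are now of order (t - s)^2. *)
Lemma expR_primitive (a g : R -> R) (M T : R) : 0 <= T ->
  measurable_fun `[0, T] g -> (forall r, r \in `[0, T] -> `|g r| <= M) ->
  (forall t, a t = \int[mu]_(r in `[0, t]) g r) ->
  [/\ measurable_fun `[0, T] a, forall t, t \in `[0, T] -> `|a t| <= M * T &
    expR (a T) = 1 + \int[mu]_(r in `[0, T]) (g r * expR (a r))].
Proof.
move=> T0 mg gM aE.
have M0 : 0 <= M by rewrite (le_trans _ (gM 0 _)) ?in_itv/= ?lexx.
have ig : mu.-integrable `[0, T] (EFin \o g).
  apply: (@measurable_normr_le_integrable _ _ _ mu _ g M) => //.
  exact: lebesgue_itv_lty.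
have ma : measurable_fun `[0, T] a.
  by rewrite (funext aE); exact: measurable_Rintegral_itv.
have a0 : a 0 = 0 by rewrite aE set_itv1 Rintegral_set1.
have alip s t : 0 <= s -> s <= t -> t <= T -> `|a t - a s| <= M * (t - s).
  by move=> s0 st tT; rewrite !aE; exact: Rintegral_sub_bounded s0 st tT mg gM.
have aB t : t \in `[0, T] -> `|a t| <= M * T.
  rewrite in_itv/= => /andP[t0 tT]; have := alip 0 t (lexx _) t0 tT.
  by rewrite a0 !subr0 => /le_trans; apply; rewrite ler_wpM2l.
split=> //.
set B := expR (M * T); have B0 : 0 <= B by exact: expR_ge0.
have eB t : t \in `[0, T] -> `|expR (a t)| <= B.
  by move=> /aB /ler_normlP[_ h]; rewrite ger0_norm ?expR_ge0// ler_expR.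
have me : measurable_fun `[0, T] (fun r => expR (a r)).
  by apply: measurableT_comp.
have iS : mu.-integrable `[0, T] (EFin \o (fun r => g r * expR (a r))).
  have := integrable_itv_mul me eB ig.
  rewrite (_ : (fun _ => _ * _) = (fun r => g r * expR (a r)))//.
  by apply/funext => r; rewrite mulrC.
pose h t := expR (a t) - \int[mu]_(r in `[0, t]) (g r * expR (a r)).
have in0T t : 0 <= t -> t <= T -> t \in `[0, T] by move=> t0 tT; rewrite in_itv/= t0.
suff hT : h T = h 0.
  have h0 : h 0 = 1 by rewrite /h set_itv1 Rintegral_set1 subr0 a0 expR0.
  by rewrite -h0 -hT /h subrK.
(* One B M^2 pays for the Taylor remainder of the exponential, the other for replacing e^(a r) by
   e^(a s) under the integral. *)
have := @eq_of_superlinear_increments h (fun t => t) T (2 * (B * M ^+ 2)) T0.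
apply => s t s0 st tT.
have t0 := le_trans s0 st; have sT := le_trans st tT.
have sub := subitv_oc s0 tT.
have igst := integrable_oc s0 tT ig.
have iSst := integrable_oc s0 tT iS.
have ts0 : 0 <= t - s by rewrite subr_ge0.
have [_ e2] := expR_increment (aB t (in0T _ t0 tT)) (aB s (in0T _ s0 sT)).
have -> : h t - h s = (expR (a t) - expR (a s) - expR (a s) * (a t - a s)) +
    \int[mu]_(r in `]s, t]) ((expR (a s) - expR (a r)) * g r).
  have ie : mu.-integrable `]s, t] (EFin \o (fun r => expR (a s) * g r)).
    by apply: (@integrableZl _ _ _ mu _ _ _ _ igst); exact: measurable_itv.
  under eq_Rintegral do rewrite mulrBl [expR (a _) * g _ in X in _ - X]mulrC.
  rewrite RintegralB// RintegralZl// -(Rintegral_sub s0 st tT ig).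
  rewrite -(Rintegral_sub s0 st tT iS) -!aE /h; ring.
rewrite (le_trans (ler_normD _ _))//.
rewrite (_ : _ * _ * _ =
  B * (M * (t - s)) ^+ 2 + B * (M * (t - s)) * (M * (t - s))); last by ring.
rewrite lerD//.
  rewrite (le_trans e2)// ler_wpM2l// ler_pXn2r ?nnegrE ?mulr_ge0//.
  exact: alip.
have := @normr_Rintegral_mul_le _ _ _ mu `]s, t] (fun r => expR (a s) - expR (a r)) g
  (B * (M * (t - s))).
move=> h1; rewrite (le_trans (h1 _ _ _ _))//.
- by apply: measurable_funB => //; apply: measurable_funS me.
- move=> r /=; rewrite in_itv/= => /andP[/ltW sr rt].
  have r0 := le_trans s0 sr; have rT := le_trans rt tT.
  have [e1 _] := expR_increment (aB s (in0T _ s0 sT)) (aB r (in0T _ r0 rT)).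
  rewrite (le_trans e1)// ler_wpM2l// distrC (le_trans (alip s r s0 sr rT))//.
  by rewrite ler_wpM2l// lerD2r.
- apply: ler_wpM2l; first by rewrite !mulr_ge0.
  rewrite -lebesgue_itv_oc// -Rintegral_cst//; apply: le_Rintegral => //.
  + exact: integrable_norm.
  + apply: (@measurable_normr_le_integrable _ _ _ mu _ (cst M) `|M|) => //.
    exact: lebesgue_itv_lty.
  + by move=> r /sub; exact: gM.
Qed.

(** The Lipschitz factor in the integration by parts is e^a, with density g e^a bounded by M e^(M
    T). [W] will be a Hermite coefficient of the path and [w] that of the integrand. *)
Lemma expR_primitive_mul (a g W w : R -> R) (M T : R) : 0 <= T ->
  measurable_fun `[0, T] g -> (forall r, r \in `[0, T] -> `|g r| <= M) ->
  (forall t, a t = \int[mu]_(r in `[0, t]) g r) ->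
  mu.-integrable `[0, T] (EFin \o w) ->
  (forall t, t \in `[0, T] -> W t = W 0 + \int[mu]_(r in `[0, t]) w r) ->
  expR (a T) * W T =
    W 0 + \int[mu]_(r in `[0, T]) (expR (a r) * w r + g r * expR (a r) * W r).
Proof.
move=> T0 mg gM aE iw WE.
have [ma aB _] := expR_primitive T0 mg gM aE.
have a0 : a 0 = 0 by rewrite aE set_itv1 Rintegral_set1.
have [||||||_ _ ->] := @integration_by_parts_bounded (expR \o a) W
  (fun r => g r * expR (a r)) w (M * expR (M * T)) T => //.
- by apply: measurable_funM => //; exact: measurableT_comp.
- move=> r rT; rewrite normrM ler_pM// ?gM//.
  by have /ler_normlP[_ h] := aB r rT; rewrite ger0_norm ?expR_ge0// ler_expR.
- move=> t; rewrite in_itv/= => /andP[t0 tT].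
  have sub := subitv_cc tT.
  have [|||_ _ ->] := @expR_primitive a g M t t0 => //.
  + exact: measurable_funS mg.
  + by move=> r rt; apply: gM; exact: (sub r rt).
  + by rewrite a0 expR0.
- by rewrite /= a0 expR0 mul1r.
Qed.

End scalar_integrals.

Section hermite_sobolev_vector_space.
Context {R : realType} {d : nat}.
Local Notation dist := (schwartz R d -> R^o).
Implicit Types (f g h : dist) (p q : R).
Local Notation hs := (@hermite_sobolev R d).

Lemma hermite_sobolevZ p (k : R) f : hs p f -> hs p (k *: f).
Proof.
move=> hf; rewrite -[k *: f]addr0; apply: hermite_sobolev_linear => //.
exact: hermite_sobolev0.
Qed.

Lemma hermite_sobolevD p f g : hs p f -> hs p g -> hs p (f + g).
Proof. by move=> hf hg; rewrite -[f]scale1r; exact: hermite_sobolev_linear. Qed.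

Lemma hermite_sobolevB p f g : hs p f -> hs p g -> hs p (f - g).
Proof.
by move=> hf hg; apply: hermite_sobolevD => //; rewrite -scaleN1r; exact: hermite_sobolevZ.
Qed.

Lemma ler_hs_normD p f g : hs p f -> hs p g ->
  hs_norm p (f + g) <= hs_norm p f + hs_norm p g.
Proof. by move=> [_ nf _] [_ ng _]; have [] := hs_normD nf ng. Qed.

Lemma hs_normZ p (k : R) f : hs p f -> hs_norm p (k *: f) = `|k| * hs_norm p f.
Proof.
move=> hf; apply/le_anti/andP; split.
  by have [_] := hs_normZ_le k (hermite_sobolev_finite hf).
have [->|k0] := eqVneq k 0; first by rewrite normr0 mul0r hs_norm_ge0.
have [_] := hs_normZ_le k^-1 (hermite_sobolev_finite (hermite_sobolevZ k hf)).
by rewrite scalerA mulVf// scale1r normfV ler_pdivlMl// normr_gt0.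
Qed.

Lemma hs_normN p f : hs p f -> hs_norm p (- f) = hs_norm p f.
Proof. by move=> hf; rewrite -scaleN1r hs_normZ// normrN1 mul1r. Qed.

Lemma ler_hs_normB p f g : hs p f -> hs p g ->
  hs_norm p (f - g) <= hs_norm p f + hs_norm p g.
Proof.
move=> hf hg; have hNg : hs p (- g) by rewrite -scaleN1r; exact: hermite_sobolevZ.
by rewrite (le_trans (ler_hs_normD hf hNg))// hs_normN.
Qed.

Lemma hs_distC p f g : hs p f -> hs p g -> hs_norm p (f - g) = hs_norm p (g - f).
Proof. by move=> hf hg; rewrite -opprB hs_normN//; exact: hermite_sobolevB. Qed.

Lemma hs_norm_lipschitz p f g : hs p f -> hs p g ->
  `|hs_norm p f - hs_norm p g| <= hs_norm p (f - g).
Proof.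
move=> hf hg.
have := ler_hs_normD (hermite_sobolevB hf hg) hg; rewrite subrK => h1.
have := ler_hs_normD (hermite_sobolevB hg hf) hf; rewrite subrK hs_distC// => h2.
by rewrite ler_norml; apply/andP; split; lra.
Qed.

End hermite_sobolev_vector_space.

(** * Bochner integrals *)

Section lower_integral.
Local Open Scope ereal_scope.
Context {dT : measure_display} {T : measurableType dT} {R : realType}.
Context {mu : {measure set T -> \bar R}}.
Import HBNNSimple.

(* [f] and [g] need not be measurable: the library's integral of a nonnegative
   function is a lower integral, and the norms of Bochner-integrable functions
   are only almost everywhere equal to Borel functions. *)
Lemma ge0_le_integral_off_null (D N : set T) (f g : T -> \bar R) :
  measurable D -> measurable N -> mu N = 0 ->
  (forall x, D x -> 0 <= f x) -> (forall x, D x -> 0 <= g x) ->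
  (forall x, D x -> ~ N x -> f x <= g x) ->
  \int[mu]_(x in D) f x <= \int[mu]_(x in D) g x.
Proof.
move=> mD mN N0 f0 g0 fg.
rewrite [leLHS]integral_mkcond [leRHS]integral_mkcond.
have p0 (h : T -> \bar R) : (forall x, D x -> 0 <= h x) -> forall x, 0 <= (h \_ D) x.
  by move=> h0 x; rewrite patchE; case: ifPn => // /set_mem/h0.
rewrite !ge0_integralTE; [|exact: p0|exact: p0].
apply: ge_ereal_sup => _ [h /= hf <-].
have mNc : measurable (~` N) by exact: measurableC.
apply: ereal_sup_ubound; exists (proj_nnsfun h mNc) => [x /=|].
  rewrite mindicE; have [xN|xN] := boolP (x \in ~` N); last by rewrite mulr0 p0.
  rewrite mulr1 (le_trans (hf x))// !patchE; case: ifPn => // /set_mem Dx.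
  by apply: fg => //; move/set_mem: xN.
have := @integral_nnsfun _ _ _ mu setT measurableT h.
have := @integral_nnsfun _ _ _ mu setT measurableT (proj_nnsfun h mNc).
rewrite !patch_setT => <- <-; apply: ae_eq_integral => //.
- by apply/measurable_EFinP.
- by apply/measurable_EFinP.
exists N; split=> // x /= H; apply: contrapT => Nx; apply: H => _ /=.
by rewrite mindicE mem_set// mulr1.
Qed.

End lower_integral.

Section null_sets.
Context {dT : measure_display} {T : measurableType dT} {R : realType}.
Context {mu : {measure set T -> \bar R}}.

Lemma eq_Rintegral_off_null (D N : set T) (f g : T -> R) :
  measurable D -> measurable N -> mu N = 0%E ->
  measurable_fun D f -> measurable_fun D g ->
  (forall x, D x -> ~ N x -> f x = g x) ->
  \int[mu]_(x in D) f x = \int[mu]_(x in D) g x.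
Proof.
move=> mD mN N0 mf mg fg; rewrite /Rintegral; congr fine.
apply: ae_eq_integral => //; [exact/measurable_EFinP|exact/measurable_EFinP|].
exists N; split=> // x /= H; apply: contrapT => Nx; apply: H => Dx.
by rewrite fg.
Qed.

End null_sets.

(** * Simple functions with values in [S_q] *)

Section simple_functions.
Context {R : realType} {d : nat}.
Local Notation mu := (@lebesgue_measure R).
Local Notation dist := (schwartz R d -> R^o).
Local Notation hs := (@hermite_sobolev R d).
Implicit Types (q : R) (D : set (measurableTypeR R)) (g : @simple R d).

Lemma simple_on_cons q D a g : simple_on q D (a :: g) ->
  [/\ measurable a.1, a.1 `<=` D, hs q a.2 & simple_on q D g].
Proof.
move=> h; have [? ? ?] := h a (mem_head _ _); split=> // b bg.
by apply: h; rewrite inE bg orbT.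
Qed.

Lemma simple_fun_cons a g s :
  simple_fun (a :: g) s = (\1_(a.1) s : R) *: a.2 + simple_fun g s.
Proof. by rewrite /simple_fun big_cons. Qed.

Lemma simple_fun_cat g g' s : simple_fun (g ++ g') s = simple_fun g s + simple_fun g' s.
Proof. by rewrite /simple_fun big_cat. Qed.

Lemma simple_on_cat q D g g' :
  simple_on q D g -> simple_on q D g' -> simple_on q D (g ++ g').
Proof. by move=> hg hg' a; rewrite mem_cat => /orP[/hg|/hg']. Qed.

Lemma hermite_sobolev_simple_fun q D g s : simple_on q D g -> hs q (simple_fun g s).
Proof.
elim: g => [_|a g IH /simple_on_cons[_ _ ha /IH hg]].
  by rewrite /simple_fun big_nil; exact: hermite_sobolev0.
by rewrite simple_fun_cons; exact: hermite_sobolev_linear.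
Qed.

Lemma hermite_sobolev_simple_integral q D g : simple_on q D g -> hs q (simple_integral g).
Proof.
elim: g => [_|a g IH /simple_on_cons[_ _ ha /IH hg]].
  by rewrite /simple_integral big_nil; exact: hermite_sobolev0.
by rewrite /simple_integral big_cons; exact: hermite_sobolev_linear.
Qed.

(** No regularity of [phi] in its second argument is asked, because a simple function has finitely
    many values. The dependence on [s] allows a second simple function inside [phi]; the induction
    peels off one indicator and shifts [phi] by its coefficient. *)
Lemma measurable_simple_fun q D g (phi : measurableTypeR R -> dist -> R) :
  simple_on q D g -> (forall f, measurable_fun setT (phi ^~ f)) ->
  measurable_fun [set: measurableTypeR R] (fun s => phi s (simple_fun g s)).
Proof.
elim: g phi => [|a g IH] phi.
  by move=> _ mphi; rewrite /simple_fun; under eq_fun do rewrite big_nil; exact: mphi.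
move=> /simple_on_cons[ma _ _ hg] mphi.
rewrite (_ : (fun s => _) = (fun s => \1_(a.1) s * phi s (a.2 + simple_fun g s) +
    (1 - \1_(a.1) s) * phi s (simple_fun g s))).
  apply: measurable_funD; apply: measurable_funM.
  - exact: measurable_indic.
  - by apply: (IH (fun s f => phi s (a.2 + f))) => // f; exact: mphi.
  - by apply: measurable_funB => //; exact: measurable_indic.
  - exact: IH.
apply/funext => s; rewrite simple_fun_cons indicE; case: (s \in a.1).
  by rewrite scale1r mul1r subrr mul0r addr0.
by rewrite scale0r add0r mul0r subr0 mul1r add0r.
Qed.

Lemma simple_fun_coef_integral q D g phi : measurable D -> (mu D < +oo)%E ->
  simple_on q D g ->
  mu.-integrable D (fun s => (simple_fun g s phi)%:E) /\
  simple_integral g phi = \int[mu]_(s in D) simple_fun g s phi.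
Proof.
move=> mD fD; elim: g => [_|a g IH /simple_on_cons[ma aD ha hg]].
  have E0 : (fun s => simple_fun (@nil (set (measurableTypeR R) * dist)) s phi) = (fun=> 0).
    by apply/funext => s; rewrite /simple_fun big_nil.
  split; last by rewrite E0 Rintegral_cst// mul0r /simple_integral big_nil.
  rewrite (_ : (fun _ => _) = cst 0%E); first exact: integrable0.
  by apply/funext => s; rewrite [in LHS](congr1 (fun f => f s) E0).
have [ig gE] := IH hg.
have i1 : mu.-integrable D (EFin \o (fun s => \1_(a.1) s)).
  apply: (@measurable_normr_le_integrable _ _ _ mu D _ 1) => //.
    by apply: measurable_funTS; exact: measurable_indic.
  by move=> r _; rewrite indicE; case: (_ \in _); rewrite ?normr1 ?normr0.
have E s : simple_fun (a :: g) s phi = a.2 phi * \1_(a.1) s + simple_fun g s phi.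
  rewrite simple_fun_cons.
  by rewrite [LHS](_ : _ = \1_(a.1) s * a.2 phi + simple_fun g s phi)// mulrC.
have i2 : mu.-integrable D (EFin \o (fun s => a.2 phi * \1_(a.1) s)).
  exact: (@integrableZl _ _ _ mu _ mD _ _ i1).
split.
  under eq_fun do rewrite E EFinD.
  exact: (@integrableD _ _ _ mu _ mD _ _ i2 ig).
under eq_Rintegral do rewrite E.
rewrite RintegralD// RintegralZl// -gE.
rewrite /simple_integral big_cons.
rewrite [LHS](_ : _ = fine (mu a.1) * a.2 phi + simple_integral g phi)// mulrC.
congr (_ * _ + _); rewrite /Rintegral integral_indic//.
by congr (fine (mu _)); apply/seteqP; split=> [x ?|x []//]; split=> //; exact: aD.
Qed.

Lemma simple_fun_norm_bounded q D g : simple_on q D g ->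
  exists B : R, forall s, hs_norm q (simple_fun g s) <= B.
Proof.
elim: g => [_|a g IH /simple_on_cons[_ _ ha hg]].
  by exists (hs_norm q (0 : dist)) => s; rewrite /simple_fun big_nil.
have [B hB] := IH hg; exists (hs_norm q a.2 + B) => s.
rewrite simple_fun_cons (le_trans (ler_hs_normD _ _))//.
- exact: hermite_sobolevZ.
- exact: hermite_sobolev_simple_fun hg.
- rewrite lerD// hs_normZ// indicE ler_piMl ?hs_norm_ge0//.
  by case: (s \in a.1); rewrite ?normr1 ?normr0.
Qed.

End simple_functions.

(** * Approximation in L^1 by simple functions, and Hermite coefficients of the integral *)

Section approximation.
Context {R : realType} {d : nat} (q : R) (D : set (measurableTypeR R)).
Hypotheses (d0 : (0 < d)%N) (mD : measurable D) (fD : (@lebesgue_measure R D < +oo)%E).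
Local Notation mu := (@lebesgue_measure R).
Local Notation dist := (schwartz R d -> R^o).
Local Notation hs := (@hermite_sobolev R d).
Implicit Types (F G : R -> dist) (g h : nat -> @simple R d)
  (N : set (measurableTypeR R)).

(* Bochner-integrable functions are limits of simple functions off a null set
   only; cutting off that set makes the quantities below Borel measurable. *)
Definition off_null N (s : R) : R := \1_(~` N) s.

Definition gap F g N n (s : R) : R :=
  hs_norm q (F s - simple_fun (g n) s) * off_null N s.

(** The content of [is_bochner] without the value of the integral. The null set is explicit and the
    integrals are real, so that approximations can be added and multiplied by scalar functions
    before any value is known. *)
Definition approximates F g N := [/\ forall n, simple_on q D (g n),
  measurable N /\ mu N = 0%E,
  forall s, D s -> ~ N s -> hs_norm q (F s - simple_fun (g n) s) @[n --> \oo] --> (0 : R),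
  forall n, mu.-integrable D (EFin \o gap F g N n) &
  (\int[mu]_(s in D) gap F g N n s) @[n --> \oo] --> (0 : R)].

Lemma off_nullT N s : ~ N s -> off_null N s = 1.
Proof. by move=> Ns; rewrite /off_null indicE mem_set. Qed.

Lemma off_nullF N s : N s -> off_null N s = 0.
Proof. by move=> Ns; rewrite /off_null indicE memNset. Qed.

Lemma off_null_01 N s : 0 <= off_null N s <= 1.
Proof. by rewrite /off_null indicE; case: (_ \in _); rewrite ?lexx ?ler01. Qed.

Lemma measurable_off_null N : measurable N -> measurable_fun D (off_null N).
Proof.
move=> mN; apply: measurable_funS (measurableT) _ _ => //.
by apply: measurable_indic; exact: measurableC.
Qed.

Lemma gap_ge0 F g N n s : 0 <= gap F g N n s.
Proof. by rewrite mulr_ge0 ?hs_norm_ge0//; have /andP[] := off_null_01 N s. Qed.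

Lemma measurable_off_null_lim N (f_ : nat -> R -> R) (f : R -> R) :
  measurable N -> (forall n, measurable_fun D (f_ n)) ->
  (forall s, D s -> ~ N s -> f_ n s @[n --> \oo] --> f s) ->
  measurable_fun D (fun s => f s * off_null N s).
Proof.
move=> mN mf f_f.
apply: (@measurable_fun_cvg _ _ _ D (fun n s => f_ n s * off_null N s)) => [n|s Ds].
  by apply: measurable_funM => //; exact: measurable_off_null.
have [Ns|Ns] := pselect (N s).
  by rewrite off_nullF// mulr0; under eq_fun do rewrite mulr0; exact: cvg_cst.
by apply: cvgM; [exact: f_f|exact: cvg_cst].
Qed.

Lemma measurable_simple_functional (phi : dist -> R) (g0 : simple) :
  simple_on q D g0 -> measurable_fun D (fun s => phi (simple_fun g0 s)).
Proof.
move=> hg; apply: measurable_funTS.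
by apply: (measurable_simple_fun (phi := fun=> phi) hg) => f; exact: measurable_cst.
Qed.

Lemma hs_norm_cvg_sub (f_ : nat -> dist) (f h : dist) : (forall n, hs q (f_ n)) ->
  hs q f -> hs q h -> hs_norm q (f - f_ n) @[n --> \oo] --> (0 : R) ->
  hs_norm q (f_ n - h) @[n --> \oo] --> hs_norm q (f - h).
Proof.
move=> hf_ hf hh f_f; apply/subr_cvg0.
apply/norm_cvg0P.
apply: (squeeze_cvgr _ (cvg_cst 0) f_f); near=> n; rewrite normr_ge0/=.
have := hs_norm_lipschitz (hermite_sobolevB (hf_ n) hh) (hermite_sobolevB hf hh).
by rewrite opprB addrA subrK [leRHS]hs_distC.
Unshelve. all: by end_near. Qed.

(** Off [N] this distance is the limit of distances between two simple functions, which are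
    measurable by [measurable_simple_fun] applied to each argument in turn. *)
Lemma measurable_hs_dist F g N (g0 : simple) : (forall s, D s -> hs q (F s)) ->
  (forall n, simple_on q D (g n)) -> measurable N ->
  (forall s, D s -> ~ N s ->
    hs_norm q (F s - simple_fun (g n) s) @[n --> \oo] --> (0 : R)) ->
  simple_on q D g0 ->
  measurable_fun D (fun s => hs_norm q (F s - simple_fun g0 s) * off_null N s).
Proof.
move=> hF hg mN gF hg0.
apply: (measurable_off_null_lim (f_ := fun n s =>
  hs_norm q (simple_fun (g n) s - simple_fun g0 s))) => // [n|s Ds Ns].
  apply: measurable_funTS.
  apply: (measurable_simple_fun (phi := fun s f => hs_norm q (f - simple_fun g0 s)) (hg n)).
  move=> f; apply: (measurable_simple_fun (phi := fun=> fun f' => hs_norm q (f - f')) hg0).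
  by move=> f'; exact: measurable_cst.
apply: hs_norm_cvg_sub; [|exact: hF| |exact: gF].
  by move=> n; exact: hermite_sobolev_simple_fun (hg n).
exact: hermite_sobolev_simple_fun hg0.
Qed.

(** The gap is measurable by the preceding lemma, so integrability and convergence to 0 have to be
    checked only for a convenient majorant [b]. *)
Lemma approximatesI F g N (b : nat -> R -> R) : (forall s, D s -> hs q (F s)) ->
  (forall n, simple_on q D (g n)) -> measurable N -> mu N = 0%E ->
  (forall s, D s -> ~ N s ->
    hs_norm q (F s - simple_fun (g n) s) @[n --> \oo] --> (0 : R)) ->
  (forall n s, D s -> gap F g N n s <= b n s) ->
  (forall n, mu.-integrable D (EFin \o b n)) ->
  (\int[mu]_(s in D) b n s) @[n --> \oo] --> (0 : R) ->
  approximates F g N.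
Proof.
move=> hF hg mN N0 gF gb ib b0.
have ig n : mu.-integrable D (EFin \o gap F g N n).
  apply: le_integrable (ib n) => //.
    by apply/measurable_EFinP; exact: measurable_hs_dist.
  move=> s Ds; rewrite /= lee_fin ger0_norm ?gap_ge0// (le_trans (gb n s Ds))//.
  exact: ler_norm.
split=> //; apply: (squeeze_cvgr _ (cvg_cst 0) b0).
apply: nearW => n; apply/andP; split.
  by apply: Rintegral_ge0 => s _; exact: gap_ge0.
by apply: le_Rintegral => // s Ds; exact: gb.
Qed.

Lemma is_bochner_approximates F v : is_bochner q D F v ->
  exists g N, approximates F g N /\
    hs_norm q (v - simple_integral (g n)) @[n --> \oo] --> (0 : R).
Proof.
move=> [hv hF [g [hg [N [mN N0 gN]] gI gv]]].
have gF s : D s -> ~ N s -> hs_norm q (F s - simple_fun (g n) s) @[n --> \oo] --> (0 : R).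
  by move=> Ds Ns; apply: contrapT => H; apply: Ns; apply: gN => /= /(_ Ds).
have gapm n : measurable_fun D (gap F g N n) by exact: measurable_hs_dist.
have gapI n : (\int[mu]_(s in D) (gap F g N n s)%:E <=
    \int[mu]_(s in D) (hs_norm q (F s - simple_fun (g n) s)%R)%:E)%E.
  apply: (ge0_le_integral_off_null mD mN N0) => s Ds.
  - by rewrite lee_fin gap_ge0.
  - by rewrite lee_fin hs_norm_ge0.
  - by move=> Ns; rewrite /gap off_nullT// mulr1.
have gap0 n : (0 <= \int[mu]_(s in D) (gap F g N n s)%:E)%E.
  by apply: integral_ge0 => s _; rewrite lee_fin gap_ge0.
have gapc : (\int[mu]_(s in D) (gap F g N n s)%:E)%E @[n --> \oo] --> 0%E.
  apply: (squeeze_cvge _ (cvg_cst 0%E) gI).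
  by apply: nearW => n; rewrite gap0 gapI.
have /fine_cvgP[[n0 _ fin] gap1] := gapc.
(* Convergence to 0 in the extended reals makes the integrals finite only from some [n0] on; the
   earlier approximants are dropped. *)
pose g' n := g (n + n0)%N.
have g'E n : gap F g' N n = gap F g N (n + n0) by [].
exists g', N; split; last by have := gv; rewrite -(cvg_shiftn n0).
split; [by move=> n; exact: hg|by split| | |].
- by move=> s Ds Ns; have := gF s Ds Ns; rewrite -(cvg_shiftn n0).
- move=> n; rewrite g'E; apply/integrableP; split.
    by apply/measurable_EFinP; exact: gapm.
  under eq_integral do rewrite gee0_abs ?lee_fin ?gap_ge0//.
  by rewrite -ge0_fin_numE ?gap0//; apply: fin; rewrite /= leq_addl.
- under eq_fun do rewrite g'E.
  pose I n := \int[mu]_(s in D) gap F g N n s.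
  have I0 : I n @[n --> \oo] --> (0 : R) by exact: gap1.
  by rewrite -(cvg_shiftn n0) in I0.
Qed.

(** By [hs_coef_le] a coefficient of F - g_n is at most a constant times the gap, so L^1 convergence
    in norm passes to every coefficient. *)
Lemma approximates_coef F g N k : (forall s, D s -> hs q (F s)) -> approximates F g N ->
  mu.-integrable D (EFin \o (fun s => F s (hermite k) * off_null N s)) /\
  simple_integral (g n) (hermite k) @[n --> \oo] -->
    \int[mu]_(s in D) (F s (hermite k) * off_null N s).
Proof.
move=> hF [hg [mN N0] gF ig g0].
have [C C0 coef] := @hs_coef_le R d q k.
have hgs n s := @hermite_sobolev_simple_fun _ _ _ _ _ s (hg n).
have diff n s : D s -> `|F s (hermite k) - simple_fun (g n) s (hermite k)| <=
    C * hs_norm q (F s - simple_fun (g n) s).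
  move=> Ds; apply: (coef (F s - simple_fun (g n) s)) => //.
  by apply: hermite_sobolev_finite; apply: hermite_sobolevB => //; exact: hF.
have mg n : measurable_fun D (fun s => simple_fun (g n) s (hermite k)).
  exact: (measurable_simple_functional (fun f => f (hermite k)) (hg n)).
have mF : measurable_fun D (fun s => F s (hermite k) * off_null N s).
  apply: (measurable_off_null_lim (f_ := fun n s => simple_fun (g n) s (hermite k))) => //.
  move=> s Ds Ns; apply/subr_cvg0; apply/norm_cvg0P.
  apply: (squeeze_cvgr _ (cvg_cst 0) (_ :
    C * hs_norm q (F s - simple_fun (g n) s) @[n --> \oo] --> (0 : R))).
    by apply: nearW => n; rewrite normr_ge0/= distrC diff.
  by rewrite -[X in _ --> X](mulr0 C); apply: cvgMr; exact: gF.
have iS n := simple_fun_coef_integral (hermite k) mD fD (hg n).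
have gapk n s : D s -> `|F s (hermite k) * off_null N s -
    simple_fun (g n) s (hermite k) * off_null N s| <= C * gap F g N n s.
  move=> Ds; have /andP[ge0 _] := off_null_01 N s.
  by rewrite -mulrBl normrM (ger0_norm ge0) /gap mulrA ler_wpM2r// diff.
have isk n : mu.-integrable D (EFin \o
    (fun s => simple_fun (g n) s (hermite k) * off_null N s)).
  apply: le_integrable (proj1 (iS n)) => //.
    by apply/measurable_EFinP; apply: measurable_funM => //; exact: measurable_off_null.
  move=> s Ds; rewrite lee_fin normrM ler_piMr//.
  by have /andP[ge0 le1] := off_null_01 N s; rewrite ger0_norm.
have igk n : mu.-integrable D (EFin \o (fun s => F s (hermite k) * off_null N s -
    simple_fun (g n) s (hermite k) * off_null N s)).
  apply: le_integrable (@integrableZl _ _ _ mu _ mD C _ (ig n)) => //.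
    apply/measurable_EFinP; apply: measurable_funB => //.
    by apply/measurable_EFinP; exact: measurable_int (isk n).
  move=> s Ds; rewrite [leRHS](_ : _ = `|C * gap F g N n s|%:E)// lee_fin.
  by rewrite (le_trans (gapk n s Ds))// ler_norm.
have iF : mu.-integrable D (EFin \o (fun s => F s (hermite k) * off_null N s)).
  (* The coefficient is written as its difference from the first approximant plus that approximant,
     both integrable. *)
  have := @integrableD _ _ _ mu _ mD _ _ (igk 0) (isk 0).
  by apply: eq_integrable => // s _; rewrite /= -EFinD subrK.
split=> //; apply/subr_cvg0; apply/norm_cvg0P.
apply: (squeeze_cvgr _ (cvg_cst 0) (_ :
    C * \int[mu]_(s in D) gap F g N n s @[n --> \oo] --> (0 : R))).
  apply: nearW => n; rewrite normr_ge0/= distrC (proj2 (iS n)).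
  have -> : \int[mu]_(s in D) simple_fun (g n) s (hermite k) =
      \int[mu]_(s in D) (simple_fun (g n) s (hermite k) * off_null N s).
    apply: (eq_Rintegral_off_null mD mN N0) => //.
      by apply: measurable_funM => //; exact: measurable_off_null.
    by move=> s Ds Ns; rewrite off_nullT// mulr1.
  rewrite -RintegralB// (le_trans (le_normr_Rintegral mD (igk n)))//.
  rewrite -RintegralZl//; apply: le_Rintegral => //.
  - exact: integrable_norm (igk n).
  - exact: (@integrableZl _ _ _ mu _ mD C _ (ig n)).
  - by move=> s Ds; exact: gapk.
by rewrite -[X in _ --> X](mulr0 C); apply: cvgMr.
Qed.

(** The norm is at most the gap to the first approximant plus the bound of that approximant. Its
    measurability is that of the distance to the empty simple function, which is 0. *)
Lemma approximates_norm_integrable F g N : (forall s, D s -> hs q (F s)) ->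
  approximates F g N ->
  mu.-integrable D (EFin \o (fun s => hs_norm q (F s) * off_null N s)).
Proof.
move=> hF [hg [mN N0] gF ig g0].
have [B hB] := simple_fun_norm_bounded (hg 0%N).
have iB : mu.-integrable D (EFin \o (fun s => gap F g N 0 s + B)).
  have iBc : mu.-integrable D (EFin \o cst B).
    by apply: (@measurable_normr_le_integrable _ _ _ mu D (cst B) `|B|).
  exact: (@integrableD _ _ _ mu _ mD _ _ (ig 0%N) iBc).
have nil0 s : simple_fun (@nil (set (measurableTypeR R) * dist)) s = 0.
  by rewrite /simple_fun big_nil.
apply: le_integrable iB => //.
  apply/measurable_EFinP.
  rewrite (_ : (fun s => _) =
      (fun s => hs_norm q (F s - simple_fun [::] s) * off_null N s)).
    exact: (measurable_hs_dist hF hg mN gF).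
  by apply/funext => s; rewrite nil0 subr0.
move=> s Ds; rewrite lee_fin; have /andP[ge0 le1] := off_null_01 N s.
rewrite ger0_norm ?mulr_ge0 ?hs_norm_ge0// (le_trans _ (ler_norm _))//.
have hgs := @hermite_sobolev_simple_fun _ _ _ _ _ s (hg 0%N).
rewrite /gap; have := ler_hs_normD (hermite_sobolevB (hF _ Ds) hgs) hgs.
rewrite subrK => h; have := ler_wpM2r ge0 h; rewrite mulrDl => /le_trans; apply.
rewrite lerD2l (le_trans _ (hB s))// ler_piMr ?hs_norm_ge0//.
Qed.

(* Testing against finitely many coefficients at a time makes the integral of
   the vector-valued H dispensable: no completeness of S_q is used. *)
Lemma hs_norm_le_Rintegral (H : R -> dist) N (b : R -> R) w : measurable N -> mu N = 0%E ->
  (forall s, D s -> hs q (H s)) ->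
  (forall k, mu.-integrable D (EFin \o (fun s => H s (hermite k)))) ->
  (forall k, w (hermite k) = \int[mu]_(s in D) H s (hermite k)) ->
  mu.-integrable D (EFin \o b) -> (forall s, D s -> 0 <= b s) ->
  (forall s, D s -> ~ N s -> hs_norm q (H s) <= b s) ->
  hs_norm q w <= \int[mu]_(s in D) b s.
Proof.
move=> mN N0 hH iH wE ib b0 Hb.
have I0 : 0 <= \int[mu]_(s in D) b s by exact: Rintegral_ge0.
have mb : measurable_fun D b by apply/measurable_EFinP; exact: measurable_int ib.
have [] // := @hs_norm_le R d q w _ I0 => X.
(* Duality with [w] itself: S is the integral of the partial inner products of [w] with [H s], hence
   at most sqrt S times the integral of [b]. Dividing by sqrt S > 0 gives the bound, and for S = 0
   nothing is to be shown. *)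
set S := hs_inner q X w w.
have S0 : 0 <= S by exact: hs_inner_ge0.
have key (l : seq {ffun 'I_d -> nat}) :
    mu.-integrable D (EFin \o (fun s => \sum_(k <- l)
       hs_weight q k * (w (hermite k) * H s (hermite k)))) /\
    \sum_(k <- l) hs_weight q k * (w (hermite k) * w (hermite k)) =
    \int[mu]_(s in D) \sum_(k <- l) hs_weight q k * (w (hermite k) * H s (hermite k)).
  elim: l => [|k l [il lE]].
    rewrite big_nil (_ : (fun s : R => _) = (fun=> 0)); last first.
      by apply/funext => s; rewrite big_nil.
    by split; [exact: integrable0|rewrite Rintegral_cst// mul0r].
  have ik : mu.-integrable D (EFin \o (fun s =>
      hs_weight q k * w (hermite k) * H s (hermite k))).
    exact: (@integrableZl _ _ _ mu _ mD _ _ (iH k)).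
  rewrite (_ : (fun s : R => _) =
    (fun s => hs_weight q k * w (hermite k) * H s (hermite k) +
      \sum_(k <- l) hs_weight q k * (w (hermite k) * H s (hermite k)))); last first.
    by apply/funext => s; rewrite big_cons mulrA.
  split; first exact: (@integrableD _ _ _ mu _ mD _ _ ik il).
  by rewrite RintegralD// RintegralZl// -wE -lE big_cons mulrA.
have [iX XE] := key (enum_fset X).
have mX : measurable_fun D (fun s => hs_inner q X w (H s)).
  by apply/measurable_EFinP; exact: measurable_int iX.
have [S_gt|] := ltP 0 S; last by move=> /le_trans; apply; exact: sqr_ge0.
have SE : S = \int[mu]_(s in D) (hs_inner q X w (H s) * off_null N s).
  rewrite [LHS]XE; apply: (eq_Rintegral_off_null mD mN N0).
  - exact: mX.
  - by apply: measurable_funM => //; exact: measurable_off_null.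
  - by move=> s Ds Ns; rewrite off_nullT// mulr1.
have CS s : D s -> hs_inner q X w (H s) * off_null N s <= Num.sqrt S * b s.
  move=> Ds; have [Ns|Ns] := pselect (N s).
    by rewrite off_nullF// mulr0 mulr_ge0 ?sqrtr_ge0 ?b0.
  rewrite off_nullT// mulr1.
  rewrite (le_trans (hs_inner_CS (sqrtr_ge0 S) (hs_norm_ge0 q (H s)) _ _))//.
  - by rewrite sqr_sqrtr.
  - by apply: hs_inner_le; exact: hermite_sobolev_finite (hH _ Ds).
  - by rewrite ler_wpM2l ?sqrtr_ge0// Hb.
have Sle : S <= Num.sqrt S * \int[mu]_(s in D) b s.
  rewrite [leLHS]SE -RintegralZl//; apply: le_Rintegral => //.
    apply: le_integrable iX => //.
      by apply/measurable_EFinP; apply: measurable_funM => //; exact: measurable_off_null.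
    move=> s Ds; rewrite lee_fin normrM ler_piMr//.
    by have /andP[ge0 le1] := off_null_01 N s; rewrite ger0_norm.
  exact: (@integrableZl _ _ _ mu _ mD _ _ ib).
have sS : 0 < Num.sqrt S by rewrite sqrtr_gt0.
rewrite -[leLHS]sqr_sqrtr// ler_pXn2r ?nnegrE ?sqrtr_ge0//.
by rewrite -(ler_pM2l sS) -expr2 sqr_sqrtr.
Qed.

Lemma approximates_is_bochner F g N w : (forall s, D s -> hs q (F s)) ->
  approximates F g N -> hs q w ->
  (forall k, w (hermite k) = \int[mu]_(s in D) (F s (hermite k) * off_null N s)) ->
  is_bochner q D F w.
Proof.
move=> hF aF hw wE; have [hg [mN N0] gF ig g0] := aF.
have hgs n s := @hermite_sobolev_simple_fun _ _ _ _ _ s (hg n).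
split=> //; exists g; split=> //.
- by exists N; split=> // s /= H; apply: contrapT => Ns; apply: H => Ds; exact: gF.
- have h : (\int[mu]_(s in D) (gap F g N n s)%:E)%E @[n --> \oo] --> 0%E.
    apply: cvg_EFin; first by apply: nearW => n; exact: integrable_fin_num (ig n).
    exact: g0.
  apply: (squeeze_cvge _ (cvg_cst 0%E) h); apply: nearW => n; apply/andP; split.
    by apply: integral_ge0 => s _; rewrite lee_fin hs_norm_ge0.
  apply: (ge0_le_integral_off_null mD mN N0) => s Ds.
  + by rewrite lee_fin hs_norm_ge0.
  + by rewrite lee_fin gap_ge0.
  + by move=> Ns; rewrite /gap off_nullT// mulr1.
- apply: (squeeze_cvgr _ (cvg_cst 0) g0); apply: nearW => n; rewrite hs_norm_ge0/=.
  (* Only [F] is cut off: this matches the coefficients of [w] given by [wE], while those of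
     [simple_integral] are integrals without cut-off. Off [N] the norm is the gap. *)
  apply: (@hs_norm_le_Rintegral
    (fun s => off_null N s *: F s - simple_fun (g n) s) N) => //.
  + move=> s Ds; apply: hermite_sobolevB => //; apply: hermite_sobolevZ; exact: hF.
  + move=> k; have [iF _] := approximates_coef k hF aF.
    have [iS _] := simple_fun_coef_integral (hermite k) mD fD (hg n).
    have := @integrableB _ _ _ mu _ mD _ _ iF iS.
    by apply: eq_integrable => // s _; rewrite /= -EFinB mulrC.
  + move=> k; have [iF _] := approximates_coef k hF aF.
    have [iS SE] := simple_fun_coef_integral (hermite k) mD fD (hg n).
    rewrite [LHS](_ : _ = w (hermite k) - simple_integral (g n) (hermite k))//.
    rewrite wE SE -RintegralB//; apply: eq_Rintegral => s _.
    by rewrite mulrC.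
  + by move=> s _; exact: gap_ge0.
  + by move=> s Ds Ns; rewrite /gap off_nullT// mulr1 scale1r.
Qed.

Lemma is_bochner_coef F g N v k : (forall s, D s -> hs q (F s)) -> hs q v ->
  approximates F g N -> hs_norm q (v - simple_integral (g n)) @[n --> \oo] --> (0 : R) ->
  v (hermite k) = \int[mu]_(s in D) (F s (hermite k) * off_null N s).
Proof.
move=> hF hv aF gv; have [_ cF] := approximates_coef k hF aF.
have [hg _ _ _ _] := aF.
have [C C0 coef] := @hs_coef_le R d q k.
suff h : simple_integral (g n) (hermite k) @[n --> \oo] --> (v (hermite k) : R).
  exact: cvg_unique h cF.
apply/subr_cvg0; apply/norm_cvg0P.
apply: (squeeze_cvgr _ (cvg_cst 0) (_ :
    C * hs_norm q (v - simple_integral (g n)) @[n --> \oo] --> (0 : R))).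
  apply: nearW => n; rewrite normr_ge0/= distrC.
  apply: (coef (v - simple_integral (g n))) => //.
  apply: hermite_sobolev_finite; apply: hermite_sobolevB => //.
  exact: hermite_sobolev_simple_integral (hg n).
by rewrite -[X in _ --> X](mulr0 C); apply: cvgMr.
Qed.

End approximation.

(** * Sums and scalar multiples of approximable functions *)

Section approximation_algebra.
Context {R : realType} {d : nat} (q : R) (D : set (measurableTypeR R)).
Hypotheses (d0 : (0 < d)%N) (mD : measurable D) (fD : (@lebesgue_measure R D < +oo)%E).
Local Notation mu := (@lebesgue_measure R).
Local Notation dist := (schwartz R d -> R^o).
Local Notation hs := (@hermite_sobolev R d).
Implicit Types (F G : R -> dist) (g h : nat -> @simple R d)
  (N : set (measurableTypeR R)) (b : R -> R).

Lemma approximatesD F g N G h N' :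
  (forall s, D s -> hs q (F s)) -> (forall s, D s -> hs q (G s)) ->
  approximates q D F g N -> approximates q D G h N' ->
  approximates q D (fun s => F s + G s) (fun n => g n ++ h n) (N `|` N').
Proof.
move=> hF hG [hg [mN N0] gF ig g0] [hh [mN' N'0] hG' ih h0].
have le s n : D s -> hs_norm q (F s + G s - simple_fun (g n ++ h n) s) <=
    hs_norm q (F s - simple_fun (g n) s) + hs_norm q (G s - simple_fun (h n) s).
  move=> Ds; rewrite simple_fun_cat opprD addrACA; apply: ler_hs_normD.
    by apply: hermite_sobolevB; [exact: hF|exact: hermite_sobolev_simple_fun (hg n)].
  by apply: hermite_sobolevB; [exact: hG|exact: hermite_sobolev_simple_fun (hh n)].
apply: (approximatesI mD (b := fun n s => gap q F g N n s + gap q G h N' n s)).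
- by move=> s Ds; apply: hermite_sobolevD; [exact: hF|exact: hG].
- by move=> n; apply: simple_on_cat; [exact: hg|exact: hh].
- exact: measurableU.
- by apply/null_set_setU.
- move=> s Ds /not_orP[Ns N's].
  have lim : hs_norm q (F s - simple_fun (g n) s) + hs_norm q (G s - simple_fun (h n) s)
      @[n --> \oo] --> (0 : R).
    by rewrite -[X in _ --> X](addr0 0); apply: cvgD; [exact: gF|exact: hG'].
  by apply: (squeeze_cvgr _ (cvg_cst 0) lim); apply: nearW => n; rewrite hs_norm_ge0 le.
- move=> n s Ds; have [|/not_orP[Ns N's]] := pselect ((N `|` N') s).
    by move=> Ns; rewrite [leLHS]/gap off_nullF// mulr0 addr_ge0 ?gap_ge0.
  rewrite /gap !off_nullT ?mulr1 ?le//.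
  by move=> [].
- by move=> n; exact: (@integrableD _ _ _ mu _ mD _ _ (ig n) (ih n)).
- have E n : \int[mu]_(s in D) (gap q F g N n s + gap q G h N' n s) =
      \int[mu]_(s in D) gap q F g N n s + \int[mu]_(s in D) gap q G h N' n s.
    by rewrite RintegralD.
  have lim : (\int[mu]_(s in D) gap q F g N n s + \int[mu]_(s in D) gap q G h N' n s)
      @[n --> \oo] --> (0 : R).
    by rewrite -[X in _ --> X](addr0 0); apply: cvgD.
  by under eq_fun do rewrite E; exact: lim.
Qed.

(** The discretisation of a nonnegative function with mesh 1 / (n + 1). It is used for a shifted
    scalar factor in [approximatesZ], and with [b] the identity for time in [approximates_path]. *)
Definition bin b n (s : R) : nat := Num.truncn (n.+1%:R * b s).

Definition bin_set b n (j : nat) : set (measurableTypeR R) :=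
  D `&` (fun s => n.+1%:R * b s) @^-1` `[j%:R, j.+1%:R[.

Definition bin_simple b n J (B : set (measurableTypeR R)) (psi : nat -> dist) : simple :=
  [seq (B `&` bin_set b n j, psi j) | j <- iota 0 J].

Lemma measurable_bin_set b n j : measurable_fun D b -> measurable (bin_set b n j).
Proof.
move=> mb; have mnb : measurable_fun D (fun s => n.+1%:R * b s).
  exact: measurable_funM.
by apply: mnb => //; exact: measurable_itv.
Qed.

Lemma simple_on_bin b n J (B : set (measurableTypeR R)) psi :
  measurable_fun D b -> measurable B -> (forall j, (j < J)%N -> hs q (psi j)) ->
  simple_on q D (bin_simple b n J B psi).
Proof.
move=> mb mB hpsi a /mapP[j]; rewrite mem_iota add0n => jJ -> /=; split.
- by apply: measurableI => //; exact: measurable_bin_set.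
- by move=> s [_ []].
- exact: hpsi.
Qed.

Lemma bin_itv b n s : 0 <= b s ->
  (bin b n s)%:R <= n.+1%:R * b s < (bin b n s).+1%:R.
Proof. by move=> b0; apply: truncn_itv; rewrite mulr_ge0. Qed.

Lemma bin_simple_fun b n J (B : set (measurableTypeR R)) psi s :
  D s -> 0 <= b s -> (bin b n s < J)%N ->
  simple_fun (bin_simple b n J B psi) s = (\1_B s : R) *: psi (bin b n s).
Proof.
move=> Ds b0 sJ; rewrite /simple_fun big_map.
rewrite (bigD1_seq (bin b n s)) ?iota_uniq//=; last by rewrite mem_iota add0n.
rewrite big1 ?addr0; last first.
  move=> j jb; rewrite indicE memNset ?scale0r// => -[_ [_ /=]].
  rewrite in_itv/= => jE; move/negP: jb; apply; apply/eqP.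
  by rewrite /bin; apply/esym/truncn_def.
congr (_ *: _); rewrite !indicE; congr (_ %:R).
have binD : bin_set b n (bin b n s) s by split=> //=; rewrite in_itv/= bin_itv.
by congr nat_of_bool; apply/idP/idP => /set_mem h; apply/mem_set; [case: h|split].
Qed.

(** [b] stands for a + M, the shift making the truncation meaningful; subtracting M from the grid
    value undoes it. The result is the product of [g] with the discretised [a]. *)
Definition mul_simple (M : R) b n J (g : @simple R d) : simple :=
  flatten [seq bin_simple b n J a.1 (fun j => (j%:R / n.+1%:R - M) *: a.2) | a <- g].

Lemma simple_on_mul M b n J (g : simple) : measurable_fun D b ->
  simple_on q D g -> simple_on q D (mul_simple M b n J g).
Proof.
move=> mb; elim: g => [//|a g IH /simple_on_cons[ma aD ha /IH hg]].
apply: simple_on_cat => //; apply: simple_on_bin => // j _.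
exact: hermite_sobolevZ.
Qed.

Lemma mul_simple_fun M b n J (g : simple) s : D s -> 0 <= b s -> (bin b n s < J)%N ->
  simple_fun (mul_simple M b n J g) s =
  ((bin b n s)%:R / n.+1%:R - M) *: simple_fun g s.
Proof.
move=> Ds b0 sJ; elim: g => [|a g IH]; first by rewrite /simple_fun !big_nil scaler0.
rewrite [mul_simple _ _ _ _ _]/(_ ++ mul_simple M b n J g) simple_fun_cat IH.
by rewrite bin_simple_fun// simple_fun_cons scalerDr !scalerA mulrC.
Qed.

(** With c_n the discretised factor, a F - c_n g_n = (a - c_n) F + c_n (F - g_n). The first term is
    at most |F| / (n + 1), with |F| integrable, and the second at most (M + 1) times the old gap. *)
Lemma approximatesZ F g N (a : R -> R) M : (forall s, D s -> hs q (F s)) ->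
  measurable_fun D a -> (forall s, D s -> `|a s| <= M) ->
  approximates q D F g N ->
  exists h, approximates q D (fun s => a s *: F s) h N.
Proof.
move=> hF ma aM aF; have [hg [mN N0] gF ig g0] := aF.
(* [b] takes values in [0, 2 M], so [J n] bins catch them all. *)
pose b s := a s + M; pose J n := (Num.truncn (n.+1%:R * (M + M))).+1.
have mb : measurable_fun D b by exact: measurable_funD.
have b0 s : D s -> 0 <= b s.
  by move=> /aM; rewrite ler_norml => /andP[h _]; rewrite -lerBlDr sub0r.
have bJ n s : D s -> (bin b n s < J n)%N.
  move=> Ds; rewrite ltnS; apply: le_truncn; rewrite ler_wpM2l// lerD2r.
  by rewrite (le_trans (ler_norm _)) ?aM.
exists (fun n => mul_simple M b n (J n) (g n)).
pose c n s : R := (bin b n s)%:R / n.+1%:R - M.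
have ca n s : D s -> `|a s - c n s| <= n.+1%:R^-1.
  move=> Ds; have /andP[h1 h2] := bin_itv n (b0 _ Ds).
  have n0 : 0 < n.+1%:R :> R by rewrite ltr0n.
  have -> : a s - c n s = (n.+1%:R * b s - (bin b n s)%:R) / n.+1%:R.
    by rewrite /c /b; field; rewrite gt_eqF.
  rewrite normrM (ger0_norm (_ : 0 <= n.+1%:R^-1)) ?invr_ge0//.
  rewrite ler_piMl ?invr_ge0// ger0_norm ?subr_ge0//.
  by move: h2; rewrite -natr1; lra.
have n1 n : n.+1%:R^-1 <= 1 :> R by rewrite invf_le1 ?ltr0n// ler1n.
have cM n s : D s -> `|c n s| <= M + 1.
  move=> Ds; have -> : c n s = a s - (a s - c n s) by rewrite opprB addrC subrK.
  by rewrite (le_trans (ler_normB _ _))// lerD ?aM// (le_trans (ca n s Ds)).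
have hgs n s := @hermite_sobolev_simple_fun _ _ _ _ _ s (hg n).
have le n s : D s -> hs_norm q (a s *: F s - simple_fun (mul_simple M b n (J n) (g n)) s) <=
    n.+1%:R^-1 * hs_norm q (F s) + (M + 1) * hs_norm q (F s - simple_fun (g n) s).
  move=> Ds; rewrite mul_simple_fun ?b0 ?bJ// -/(c n s).
  have -> : a s *: F s - c n s *: simple_fun (g n) s =
      (a s - c n s) *: F s + c n s *: (F s - simple_fun (g n) s).
    by rewrite [(a s - c n s) *: _]scalerBl [c n s *: (_ - _)]scalerBr addrA subrK.
  have hFg : hs q (F s - simple_fun (g n) s) by apply: hermite_sobolevB => //; exact: hF.
  have hcFg := hermite_sobolevZ (c n s) hFg.
  rewrite (le_trans (ler_hs_normD (hermite_sobolevZ _ (hF s Ds)) hcFg))//.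
  rewrite (hs_normZ _ (hF s Ds)) (hs_normZ _ hFg).
  by rewrite lerD// ler_wpM2r ?hs_norm_ge0 ?ca ?cM.
have iF := approximates_norm_integrable mD fD hF aF.
have iFn n := @integrableZl _ _ _ mu _ mD n.+1%:R^-1 _ iF.
have ign n := @integrableZl _ _ _ mu _ mD (M + 1) _ (ig n).
have c0 (x : R) : n.+1%:R^-1 * x @[n --> \oo] --> (0 : R).
  by rewrite -[X in _ --> X](mul0r x); apply: cvgMl; exact: cvg_harmonic.
apply: (approximatesI mD (b := fun n s => n.+1%:R^-1 * (hs_norm q (F s) * off_null N s) +
    (M + 1) * gap q F g N n s)) => //.
- by move=> s Ds; apply: hermite_sobolevZ; exact: hF.
- by move=> n; exact: simple_on_mul.
- move=> s Ds Ns.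
  have lim : n.+1%:R^-1 * hs_norm q (F s) + (M + 1) * hs_norm q (F s - simple_fun (g n) s)
      @[n --> \oo] --> (0 : R).
    rewrite -[X in _ --> X](addr0 0); apply: cvgD; first exact: c0.
    by rewrite -[X in _ --> X](mulr0 (M + 1)); apply: cvgMr; exact: gF.
  by apply: (squeeze_cvgr _ (cvg_cst 0) lim); apply: nearW => n; rewrite hs_norm_ge0 le.
- move=> n s Ds; have /andP[ge0 _] := off_null_01 N s.
  rewrite [leLHS]/gap (le_trans (ler_wpM2r ge0 (le n s Ds)))//.
  by rewrite mulrDl -!mulrA.
- by move=> n; exact: (@integrableD _ _ _ mu _ mD _ _ (iFn n) (ign n)).
- have E n : \int[mu]_(s in D) (n.+1%:R^-1 * (hs_norm q (F s) * off_null N s) +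
      (M + 1) * gap q F g N n s) =
      n.+1%:R^-1 * \int[mu]_(s in D) (hs_norm q (F s) * off_null N s) +
      (M + 1) * \int[mu]_(s in D) gap q F g N n s.
    by rewrite RintegralD ?RintegralZl//; [exact: iFn|exact: ign].
  have lim : n.+1%:R^-1 * \int[mu]_(s in D) (hs_norm q (F s) * off_null N s) +
      (M + 1) * \int[mu]_(s in D) gap q F g N n s @[n --> \oo] --> (0 : R).
    rewrite -[X in _ --> X](addr0 0); apply: cvgD; first exact: c0.
    by rewrite -[X in _ --> X](mulr0 (M + 1)); apply: cvgMr.
  by under eq_fun do rewrite E; exact: lim.
Qed.

End approximation_algebra.

(** * Continuous paths and the product rule in [S_q] *)

Section paths.
Context {R : realType} {d : nat}.
Local Notation mu := (@lebesgue_measure R).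
Local Notation dist := (schwartz R d -> R^o).
Local Notation hs := (@hermite_sobolev R d).
Implicit Types (p q T : R) (u : R -> dist).

Lemma hs_path_hs p T u s : hs_path p T u -> s \in `[0, T] -> hs p (u s).
Proof. by move=> hu /hu[]. Qed.

Lemma hs_path_bounded p T u : 0 <= T -> hs_path p T u ->
  exists B : R, forall s, s \in `[0, T] -> hs_norm p (u s) <= B.
Proof.
move=> T0 hu.
have cu : {within `[0, T], continuous (fun s => hs_norm p (u s) : R)}.
  apply/subspace_continuousP => t tT; have [ht ut] := hu t tT.
  apply/subr_cvg0; apply/norm_cvg0P.
  apply: (squeeze_cvgr _ (cvg_cst 0) ut); near=> s; rewrite normr_ge0/=.
  apply: hs_norm_lipschitz => //; apply: (hs_path_hs hu).
  by near: s; exact: withinT.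
have [c _ hc] := EVT_max T0 cu.
by exists (hs_norm p (u c)).
Unshelve. all: by end_near. Qed.

Lemma hs_pathZ p T (a : R -> R) u K : 0 <= T ->
  (forall s t, s \in `[0, T] -> t \in `[0, T] -> `|a s - a t| <= K * `|s - t|) ->
  hs_path p T u -> hs_path p T (fun s => a s *: u s).
Proof.
move=> T0 aK hu t tT; have [hut ut] := hu t tT.
split; first exact: hermite_sobolevZ.
have [B hB] := hs_path_bounded T0 hu.
have lim : K * `|s - t| * B + `|a t| * hs_norm p (u s - u t)
    @[s --> within `[0, T] (nbhs t)] --> (0 : R).
  rewrite -[X in _ --> X](addr0 0); apply: cvgD; last first.
    by rewrite -[X in _ --> X](mulr0 `|a t|); apply: cvgMr.
  rewrite -[X in _ --> X](mul0r B); apply: cvgMl.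
  rewrite -[X in _ --> X](mulr0 K); apply: cvgMr.
  apply/norm_cvg0P; apply/subr_cvg0; apply: cvg_within_filter; exact: cvg_id.
apply: (squeeze_cvgr _ (cvg_cst 0) lim); near=> s; rewrite hs_norm_ge0/=.
have sT : s \in `[0, T] by near: s; exact: withinT.
have hus := hs_path_hs hu sT.
have -> : a s *: u s - a t *: u t = (a s - a t) *: u s + a t *: (u s - u t).
  by rewrite scalerBl scalerBr addrA subrK.
have hst := hermite_sobolevB hus hut.
rewrite (le_trans (ler_hs_normD (hermite_sobolevZ _ hus) (hermite_sobolevZ _ hst)))//.
rewrite (hs_normZ _ hus) (hs_normZ _ hst) lerD// ler_pM ?hs_norm_ge0 ?hB//.
exact: aK.
Unshelve. all: by end_near. Qed.

(** The approximants sample the path at the left grid points. They converge everywhere, so the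
    exceptional set is empty, and the gaps are bounded by twice a bound of the path, so dominated
    convergence applies. *)
Lemma approximates_path p q T u : (0 < d)%N -> q <= p -> 0 <= T -> hs_path p T u ->
  exists g, approximates q `[0, T] u g set0.
Proof.
move=> d0 qp T0 hu.
have huq s : s \in `[0, T] -> hs q (u s).
  by move=> /(hs_path_hs hu); exact: hermite_sobolev_mono.
have mD : measurable (`[0, T]%classic : set (measurableTypeR R)) by exact: measurable_itv.
have fD : (mu `[0%R, T]%classic < +oo)%E by exact: lebesgue_itv_lty.
pose J n := (Num.truncn (n.+1%:R * T)).+1.
pose g n := @bin_simple R d `[0, T] id n (J n) `[0, T] (fun j => u (j%:R / n.+1%:R)).
have n0 n : 0 < n.+1%:R :> R by rewrite ltr0n.
have JT n j : (j < J n)%N -> j%:R / n.+1%:R \in `[0, T].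
  rewrite ltnS => jn; rewrite in_itv/= divr_ge0//= ler_pdivrMr// mulrC.
  have : (Num.truncn (n.+1%:R * T))%:R <= n.+1%:R * T.
    by rewrite truncn_le mulr_ge0.
  by apply: le_trans; rewrite ler_nat.
have hg n : simple_on q `[0, T] (g n).
  by apply: simple_on_bin => // j /JT/huq.
have gE n s : s \in `[0, T] ->
    simple_fun (g n) s = u ((bin id n s)%:R / n.+1%:R) /\
    ((bin id n s)%:R / n.+1%:R \in `[0, T]) /\
    `|(bin id n s)%:R / n.+1%:R - s| <= n.+1%:R^-1.
  move=> sT; have /andP[s0 sT'] : 0 <= s <= T by rewrite in_itv in sT.
  have sJ : (bin id n s < J n)%N by rewrite ltnS; apply: le_truncn; rewrite ler_wpM2l.
  split; first by rewrite bin_simple_fun// indicE mem_set// scale1r.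
  split; first exact: JT.
  have /andP[h1 h2] := @bin_itv R id n s s0.
  have -> : (bin id n s)%:R / n.+1%:R - s = - ((n.+1%:R * s - (bin id n s)%:R) / n.+1%:R).
    by field; rewrite gt_eqF.
  rewrite normrN normrM (ger0_norm (_ : 0 <= n.+1%:R^-1)) ?invr_ge0//.
  rewrite ler_piMl ?invr_ge0// ger0_norm ?subr_ge0//.
  by move: h2; rewrite -natr1 /=; lra.
have gu s : s \in `[0, T] -> hs_norm q (u s - simple_fun (g n) s) @[n --> \oo] --> (0 : R).
  move=> sT; have [hus us] := hu s sT.
  (* The path is continuous only relative to [0, T], so the grid points have to converge to [s] in
     that filter. *)
  have lim : (bin id n s)%:R / n.+1%:R @[n --> \oo] --> within `[0, T] (nbhs s).
    move=> A wA; suff cv : (bin id n s)%:R / n.+1%:R @[n --> \oo] --> s.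
      have : \forall n \near \oo, (bin id n s)%:R / n.+1%:R \in `[0, T] ->
          A ((bin id n s)%:R / n.+1%:R) := cv _ wA.
      by apply: filterS => n h; apply: h; have [_ []] := gE n s sT.
    apply/subr_cvg0; apply/norm_cvg0P.
    apply: (squeeze_cvgr _ (cvg_cst 0) (@cvg_harmonic R)); apply: nearW => n.
    by rewrite normr_ge0/=; have [_ []] := gE n s sT.
  have := cvg_comp _ _ lim us => h.
  apply: (squeeze_cvgr _ (cvg_cst 0) h); apply: nearW => n; rewrite hs_norm_ge0/=.
  have [-> [bT _]] := gE n s sT.
  have hb := hs_path_hs hu bT.
  rewrite hs_distC; [|exact: huq|exact: huq].
  by have [_] := hs_norm_mono d0 qp (hermite_sobolev_finite (hermite_sobolevB hb hus)).
have [B hB] := hs_path_bounded T0 hu.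
have gapB n s : s \in `[0, T] -> `|gap q u g set0 n s| <= B + B.
  move=> sT; rewrite ger0_norm ?gap_ge0// /gap off_nullT// mulr1.
  have [-> [bT _]] := gE n s sT.
  have hb := hs_path_hs hu bT; have hus := hs_path_hs hu sT.
  have [_ le] := hs_norm_mono d0 qp (hermite_sobolev_finite (hermite_sobolevB hus hb)).
  rewrite (le_trans le)// (le_trans (ler_hs_normB hus hb))//.
  by rewrite lerD ?hB.
have mgap n : measurable_fun `[0, T] (gap q u g set0 n).
  apply: (measurable_hs_dist huq hg) => //.
  by move=> s sT _; exact: gu.
have igap n : mu.-integrable `[0, T] (EFin \o gap q u g set0 n).
  apply: (@measurable_normr_le_integrable _ _ _ mu _ (gap q u g set0 n) (B + B)) => //.
    exact: mgap.
  by move=> s sT; exact: gapB.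
exists g; split => //.
  by move=> s sT _; exact: gu.
apply: fine_cvg; rewrite -[X in _ --> X](integral0 mu `[0, T]%classic).
apply: (@dominated_cvg _ _ _ mu _ mD _ _ (cst (B + B)%:E)) => //.
- by move=> n; apply/measurable_EFinP; exact: mgap.
- move=> s sT; apply: cvg_EFin; first exact: nearW.
  have := gu s sT; apply: cvg_trans; apply: near_eq_cvg; apply: nearW => n.
  by rewrite /= /gap off_nullT// mulr1.
- by apply: (@measurable_normr_le_integrable _ _ _ mu _ (cst (B + B)) `|B + B|).
Qed.

Lemma eq_is_bochner q (D : set R) (F G : R -> dist) v :
  (forall s, D s -> F s = G s) -> is_bochner q D F v -> is_bochner q D G v.
Proof.
move=> FG [hv hF [g [hg ae Fi gv]]]; split=> // [s Ds|].
  by rewrite -FG//; exact: hF.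
exists g; split=> //.
  have [N [mN N0 gN]] := ae; exists N; split=> // s /= H; apply: gN => /= H'.
  by apply: H => Ds; rewrite -FG//; exact: H'.
have E n : (\int[mu]_(s in D) (hs_norm q (G s - simple_fun (g n) s)%R)%:E =
    \int[mu]_(s in D) (hs_norm q (F s - simple_fun (g n) s)%R)%:E)%E.
  by apply: eq_integral => s /set_mem Ds; rewrite FG.
by under eq_fun do rewrite E.
Qed.

(** The integral equation is assumed at every t in [0, T], although the conclusion concerns only T:
    each coefficient of [u] must be known as a primitive on the whole interval before
    [expR_primitive_mul] applies. *)
Lemma is_bochner_expR p q T M (u0 : dist) u (F : R -> dist) (a c : R -> R) :
  (0 < d)%N -> 0 <= T -> q <= p -> hs_path p T u ->
  measurable_fun `[0, T] c -> (forall s, s \in `[0, T] -> `|c s| <= M) ->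
  (forall t, a t = \int[mu]_(s in `[0, t]) c s) ->
  (forall t, t \in `[0, T] -> is_bochner q `[0, t] F (u t - u0)) ->
  is_bochner q `[0, T] (fun s => expR (a s) *: F s + (c s * expR (a s)) *: u s)
    (expR (a T) *: u T - u0).
Proof.
move=> d0 T0 qp hu mc cM aE bF.
have mI t : measurable (`[0, t]%classic : set (measurableTypeR R)) by exact: measurable_itv.
have fI t : (mu `[0%R, t]%classic < +oo)%E by exact: lebesgue_itv_lty.
have TT : T \in `[0, T] by rewrite in_itv/= T0 lexx.
have [hv hF _] := bF T TT.
have [g [N [aF gv]]] := is_bochner_approximates (mI T) (bF T TT).
have huq s : s \in `[0, T] -> hermite_sobolev q (u s).
  by move=> /(hs_path_hs hu); exact: hermite_sobolev_mono.
have [ma aB _] := expR_primitive T0 mc cM aE.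
have me : measurable_fun `[0, T] (fun s => expR (a s)) by exact: measurableT_comp.
have eB s : s \in `[0, T] -> `|expR (a s)| <= expR (M * T).
  by move=> /aB /ler_normlP[_ h]; rewrite ger0_norm ?expR_ge0// ler_expR.
have mce : measurable_fun `[0, T] (fun s => c s * expR (a s)) by exact: measurable_funM.
have ceB s : s \in `[0, T] -> `|c s * expR (a s)| <= M * expR (M * T).
  by move=> sT; rewrite normrM ler_pM// ?cM ?eB.
have [gu au] := approximates_path d0 qp T0 hu.
have [h1 ah1] := approximatesZ (mI T) (fI T) hF me eB aF.
have [h2 ah2] := approximatesZ (mI T) (fI T) huq mce ceB au.
have heF s : s \in `[0, T] -> hermite_sobolev q (expR (a s) *: F s).
  by move=> sT; apply: hermite_sobolevZ; exact: hF.
have hcu s : s \in `[0, T] -> hermite_sobolev q ((c s * expR (a s)) *: u s).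
  by move=> sT; apply: hermite_sobolevZ; exact: huq.
have ah := approximatesD (mI T) heF hcu ah1 ah2.
have hG s : s \in `[0, T] ->
    hermite_sobolev q (expR (a s) *: F s + (c s * expR (a s)) *: u s).
  by move=> sT; apply: hermite_sobolevD; [exact: heF|exact: hcu].
apply: (approximates_is_bochner d0 (mI T) (fI T) hG ah).
  apply: hermite_sobolevB; first by apply: hermite_sobolevZ; exact: huq.
  (* [u0] lies in [S_q] as the difference of [u T] and the Bochner integral u T - u0. *)
  by rewrite -[u0](subKr (u T)); apply: hermite_sobolevB => //; exact: huq.
move=> k.
have [iF _] := approximates_coef d0 (mI T) (fI T) k hF aF.
have [iu _] := approximates_coef d0 (mI T) (fI T) k huq au.
have [iG _] := approximates_coef d0 (mI T) (fI T) k hG ah.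
have [_ [mN N0] _ _ _] := aF.
have mEF f D : mu.-integrable D (EFin \o f) -> measurable_fun D f.
  by move=> h; apply/measurable_EFinP; exact: measurable_int h.
(* The hypothesis at t comes with its own approximants and null set [N']. Discarding the union of
   [N] and [N'] exchanges it for the one density that is fixed for all t. *)
have uE t : t \in `[0, T] -> u t (hermite k) = u0 (hermite k) +
    \int[mu]_(s in `[0, t]) (F s (hermite k) * off_null N s).
  move=> tT; have /andP[t0 tT'] : 0 <= t <= T by rewrite in_itv in tT.
  have [hvt hFt _] := bF t tT.
  have [g' [N' [aF' gv']]] := is_bochner_approximates (mI t) (bF t tT).
  have [_ [mN' N'0] _ _ _] := aF'.
  have [iF' _] := approximates_coef d0 (mI t) (fI t) k hFt aF'.
  have := is_bochner_coef d0 (mI t) (fI t) k hFt hvt aF' gv'.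
  rewrite [LHS](_ : _ = u t (hermite k) - u0 (hermite k))// => ukE.
  rewrite -[LHS](subrK (u0 (hermite k))) ukE addrC; congr (_ + _).
  apply: (@eq_Rintegral_off_null _ _ _ mu _ (N `|` N')) => //.
  - exact: measurableU.
  - exact: null_set_setU.
  - exact: mEF.
  - by apply: measurable_funS (mEF _ _ iF) => //; exact: subitv_cc.
  - by move=> s _ /not_orP[Ns N's]; rewrite !off_nullT.
have u00 : u 0 (hermite k) = u0 (hermite k).
  by rewrite uE ?in_itv/= ?lexx// set_itv1 Rintegral_set1 addr0.
rewrite [LHS](_ : _ = expR (a T) * u T (hermite k) - u0 (hermite k))//.
rewrite (@expR_primitive_mul _ a c (fun t => u t (hermite k))
  (fun s => F s (hermite k) * off_null N s) M T)//; last first.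
  by move=> t tT; rewrite u00 uE.
rewrite u00 addrC addKr.
apply: (eq_Rintegral_off_null (mI T) mN N0).
- apply: measurable_funD; apply: measurable_funM => //; first exact: mEF.
  apply: (eq_measurable_fun (fun s => u s (hermite k) * off_null set0 s)); last exact: mEF.
  by move=> s _; rewrite off_nullT// mulr1.
- exact: mEF.
- move=> s sT Ns; rewrite !off_nullT ?mulr1//; last by case.
Qed.

End paths.

(** * The path transform and the two equations *)

Section path_transform.
Context {R : realType} {d : nat} (p T : R).
Local Notation mu := (@lebesgue_measure R).
Local Notation dist := (schwartz R d -> R^o).
Context (c : R -> (R -> dist) -> R).
Hypotheses (d0 : (0 < d)%N) (T0 : 0 <= T).
Hypothesis cm : forall y, hs_path p T y -> measurable_fun `[0, T] (fun s => c s y).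
Hypothesis cl : exists beta : R, forall t y1 y2, t \in `[0, T] ->
  hs_path p T y1 -> hs_path p T y2 ->
  `|c t y1 - c t y2| <= beta * path_norm p (fun s => y1 s - y2 s) t.
Hypothesis cb : forall alpha : R, 0 < alpha -> exists M : R, forall t y,
  t \in `[0, T] -> hs_path p T y -> path_norm p y T <= alpha -> `|c t y| <= M.
Implicit Types (y z : R -> dist).

Lemma path_norm_le y t (B : R) : 0 <= t ->
  (forall s, s \in `[0, t] -> hs_norm p (y s) <= B) -> path_norm p y t <= B.
Proof.
move=> t0 yB; apply: ge_sup => [|_ [s st <-]]; last exact: yB.
by exists (hs_norm p (y 0)), 0 => //=; rewrite in_itv/= lexx.
Qed.

Lemma path_norm_ge0 y t : 0 <= path_norm p y t.
Proof. by apply: sup_nonneg => _ [s _ <-]; exact: hs_norm_ge0. Qed.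

Lemma coefficient_bounded y : hs_path p T y ->
  exists M : R, forall t, t \in `[0, T] -> `|c t y| <= M.
Proof.
move=> hy; have [B hB] := hs_path_bounded T0 hy.
have B1 : 0 < `|B| + 1 by rewrite ltr_wpDl.
have [M hM] := cb B1; exists M => t tT; apply: hM => //.
apply: path_norm_le => // s sT; rewrite (le_trans (hB s sT))//.
by rewrite (le_trans (ler_norm B))// lerDl.
Qed.

(** Paths are functions on the whole line, and a chosen hat is determined on [0, T] only. The
    Lipschitz condition forces [c] to ignore the values outside, since the path norm of the
    difference vanishes. *)
Lemma coefficient_ext y z t : hs_path p T y -> hs_path p T z ->
  (forall s, s \in `[0, T] -> y s = z s) -> t \in `[0, T] -> c t y = c t z.
Proof.
move=> hy hz yz tT; have [beta hb] := cl.
have /andP[t0 tT'] : 0 <= t <= T by rewrite in_itv in tT.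
have E : path_norm p (fun s => y s - z s) t = 0.
  apply/le_anti; rewrite path_norm_ge0 andbT; apply: path_norm_le => // s st.
  have sT : s \in `[0, T] by exact: (subitv_cc tT') st.
  by rewrite yz// subrr; have [_ ->] := @hs_norm0 R d p.
apply/eqP; rewrite -subr_eq0 -normr_le0; have := hb t y z tT hy hz.
by rewrite E mulr0.
Qed.

Lemma hat_unique y z1 z2 : hs_path p T y -> hs_path p T z1 -> hs_path p T z2 ->
  (forall t, t \in `[0, T] -> z1 t = expR (- \int[mu]_(s in `[0, t]) c s z1) *: y t) ->
  (forall t, t \in `[0, T] -> z2 t = expR (- \int[mu]_(s in `[0, t]) c s z2) *: y t) ->
  forall t, t \in `[0, T] -> z1 t = z2 t.
Proof.
move=> hy hz1 hz2 z1E z2E.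
pose a1 t := \int[mu]_(s in `[0, t]) c s z1.
pose a2 t := \int[mu]_(s in `[0, t]) c s z2.
suff a12 : forall t, t \in `[0, T] -> a1 t = a2 t.
  by move=> t tT; rewrite z1E// z2E// -/(a1 t) -/(a2 t) a12.
have [M1 hM1] := coefficient_bounded hz1; have [M2 hM2] := coefficient_bounded hz2.
have [Y hY] := hs_path_bounded T0 hy; have [beta hbeta] := cl.
have [_ a1B _] := expR_primitive T0 (cm hz1) hM1 (fun=> erefl).
have [_ a2B _] := expR_primitive T0 (cm hz2) hM2 (fun=> erefl).
(* [L] bounds both exponents, so e^L is a Lipschitz constant for the exponential there; [Y] bounds
   the common factor [y]. *)
pose L := Num.max (M1 * T) (M2 * T); pose K := expR L * `|Y|.
have zK s : s \in `[0, T] -> hs_norm p (z1 s - z2 s) <= K * `|a1 s - a2 s|.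
  move=> sT; rewrite z1E// z2E// -scalerBl hs_normZ; last exact: hs_path_hs hy sT.
  have [|| e1 _] := @expR_increment R (- a1 s) (- a2 s) L.
  - by rewrite normrN le_max a1B.
  - by rewrite normrN le_max a2B ?orbT.
  rewrite /K mulrAC ler_pM ?hs_norm_ge0//; last first.
    by rewrite (le_trans (hY s sT))// ler_norm.
  by rewrite (le_trans e1)// opprK addrC distrC.
pose B := `|beta| * K.
have B0 : 0 <= B by rewrite !mulr_ge0 ?expR_ge0.
(* A step length with B delta <= 1/2. It does not depend on the starting point, so finitely many
   steps cover [0, T]; the summand 1 covers B = 0. *)
pose delta := (2 * (B + 1))^-1.
have delta0 : 0 < delta by rewrite invr_gt0 mulr_gt0// ltr_wpDl.
have Bd : B * delta <= 2^-1.
  rewrite /delta invfM mulrCA ler_piMr ?invr_ge0//.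
  by rewrite ler_pdivrMr ?mul1r ?lerDl// ltr_wpDl.
have step n : forall t, t \in `[0, T] -> t <= n%:R * delta -> a1 t = a2 t.
  elim: n => [|n IH] t.
    rewrite in_itv/= mul0r => /andP[t0 _] t0'.
    have -> : t = 0 by apply/le_anti/andP.
    by rewrite /a1 /a2 set_itv1 !Rintegral_set1.
  move=> tT tn; have /andP[t0 tT'] : 0 <= t <= T by rewrite in_itv in tT.
  have sub := subitv_cc tT'.
  have [/(IH t tT)//|nt] := leP t (n%:R * delta).
  set r := n%:R * delta in nt IH *.
  have r0 : 0 <= r by rewrite mulr_ge0// ltW.
  pose E := sup [set `|a1 v - a2 v| | v in `[0, t]].
  have ubE : has_ubound [set `|a1 v - a2 v| | v in `[0, t]].
    exists (M1 * T + M2 * T) => _ [v vt <-]; have vT := sub _ vt.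
    by rewrite (le_trans (ler_normB _ _))// lerD ?a1B ?a2B.
  have leE v : v \in `[0, t] -> `|a1 v - a2 v| <= E.
    by move=> vt; apply: ub_le_sup => //; exists v.
  have E0 : 0 <= E by apply: sup_nonneg => _ [v _ <-].
  have cE s : s \in `[0, t] -> `|c s z1 - c s z2| <= B * E.
    move=> st; have sT := sub _ st.
    have /andP[s0 st'] : 0 <= s <= t by rewrite in_itv in st.
    rewrite (le_trans (hbeta s _ _ sT hz1 hz2))//.
    rewrite (le_trans (ler_wpM2r (path_norm_ge0 _ _) (ler_norm beta)))//.
    rewrite /B -mulrA ler_wpM2l//; apply: path_norm_le => // v vs.
    have vt : v \in `[0, t] := subitv_cc st' vs.
    by rewrite (le_trans (zK v (sub _ vt)))// ler_wpM2l ?leE// mulr_ge0 ?expR_ge0.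
  (* The exponents agree up to r by induction. Beyond r their difference is an integral of something
     at most B E over a length at most [delta]. As E is the supremum of a bounded set, this forces E
     = 0. *)
  have EE : E <= 2^-1 * E.
    apply: ge_sup => [|_ [v vt <-]].
      by exists `|a1 0 - a2 0|, 0 => //=; rewrite in_itv/= lexx.
    have vT := sub _ vt; have /andP[v0 vt'] : 0 <= v <= t by have := vt; rewrite /= in_itv.
    have [/(IH v vT)->|rv] := leP v r; first by rewrite subrr normr0 mulr_ge0.
    have rT : r \in `[0, T] by rewrite in_itv/= r0 (le_trans (ltW nt)).
    have i1 : mu.-integrable `[0, t] (EFin \o (fun s => c s z1)).
      apply: (@measurable_normr_le_integrable _ _ _ mu _ _ M1) => //.
      + exact: lebesgue_itv_lty.
      + exact: measurable_funS (cm hz1).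
      + by move=> s /sub; exact: hM1.
    have i2 : mu.-integrable `[0, t] (EFin \o (fun s => c s z2)).
      apply: (@measurable_normr_le_integrable _ _ _ mu _ _ M2) => //.
      + exact: lebesgue_itv_lty.
      + exact: measurable_funS (cm hz2).
      + by move=> s /sub; exact: hM2.
    have bnd := @Rintegral_sub_bounded R (fun s => c s z1 - c s z2) r v t
      (B * E) r0 (ltW rv) vt'.
    have diff w : 0 <= w -> w <= t ->
        \int[mu]_(s in `[0, w]) (c s z1 - c s z2) = a1 w - a2 w.
      move=> w0 wt; apply: RintegralB => //.
        by apply: integrableS i1 => //; exact: subitv_cc.
      by apply: integrableS i2 => //; exact: subitv_cc.
    have := bnd _ cE; rewrite !diff// ?(ltW nt)// (IH r rT)// subrr subr0.
    move=> h; rewrite (le_trans (h _))//.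
      apply: measurable_funB; first exact: measurable_funS (cm hz1).
      exact: measurable_funS (cm hz2).
    rewrite (@le_trans _ _ (B * E * delta))//.
      rewrite ler_wpM2l ?mulr_ge0// lerBlDl (le_trans vt')// (le_trans tn)//.
      by rewrite /r -natr1 mulrDl mul1r.
    by rewrite mulrAC ler_wpM2r.
  have E00 : E = 0 by apply/le_anti; rewrite E0 andbT; lra.
  apply/eqP; rewrite -subr_eq0 -normr_le0 -E00 leE// in_itv/= t0 lexx//.
move=> t tT; have /andP[t0 tT'] : 0 <= t <= T by rewrite in_itv in tT.
apply: (step (Num.truncn (t / delta)).+1) => //.
by rewrite -ler_pdivrMr// ltW// truncnS_gt.
Qed.

End path_transform.

Lemma expR_Rintegral_lipschitz (R : realType) (T M : R) (a c : R -> R) : 0 <= T ->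
  measurable_fun `[0, T] c -> (forall s, s \in `[0, T] -> `|c s| <= M) ->
  (forall t, a t = \int[lebesgue_measure]_(s in `[0, t]) c s) ->
  forall s t, s \in `[0, T] -> t \in `[0, T] ->
    `|expR (a s) - expR (a t)| <= expR (M * T) * M * `|s - t|.
Proof.
move=> T0 mc cM aE s t sT tT.
have [_ aB _] := expR_primitive T0 mc cM aE.
have [e1 _] := expR_increment (aB s sT) (aB t tT).
rewrite (le_trans e1)// -mulrA ler_wpM2l ?expR_ge0//.
wlog st : s t sT tT {e1} / t <= s => [H|].
  by have [ts|/ltW st] := leP t s; [exact: H|rewrite distrC (distrC s); exact: H].
move: sT tT; rewrite !in_itv/= => /andP[s0 sT] /andP[t0 tT].
rewrite (ger0_norm (_ : 0 <= s - t)) ?subr_ge0// !aE.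
exact: (Rintegral_sub_bounded t0 st sT mc cM).
Qed.

(** Homogeneity holds with the coefficients frozen. [opL] itself need not be homogeneous; in the
    transform the coefficients stay at the hat path while the differentiated argument is scaled. *)
Lemma second_orderZ (R : realType) (d : nat) (A : 'M[R]_d) (B : 'rV[R]_d) (k : R)
  (f : schwartz R d -> R^o) : second_order A B (k *: f) = k *: second_order A B f.
Proof.
have dZ i (h : schwartz R d -> R^o) : dpartial i (k *: h) = k *: dpartial i h.
  by apply/funext => phi; rewrite /dpartial [RHS](_ : _ = k * - h (spartial i phi))// mulrN.
have E1 : \sum_(i < d) \sum_(j < d) (A *m A^T) i j *: dpartial i (dpartial j (k *: f)) =
    k *: \sum_(i < d) \sum_(j < d) (A *m A^T) i j *: dpartial i (dpartial j f).
  rewrite scaler_sumr; apply: eq_bigr => i _; rewrite scaler_sumr.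
  by apply: eq_bigr => j _; rewrite !dZ !scalerA mulrC.
have E2 : \sum_(i < d) B 0 i *: dpartial i (k *: f) =
    k *: \sum_(i < d) B 0 i *: dpartial i f.
  by rewrite scaler_sumr; apply: eq_bigr => i _; rewrite dZ !scalerA mulrC.
by rewrite /second_order E1 E2 scalerBr !scalerA mulrC.
Qed.

Lemma hs_pathS (R : realType) (d : nat) (p t T : R) (u : R -> schwartz R d -> R^o) :
  t <= T -> hs_path p T u -> hs_path p t u.
Proof.
move=> tT hu s st; have sub := subitv_cc tT.
have [hs cs] := hu s (sub s st); split=> //; apply: cvg_trans cs; apply: cvg_app.
move=> A wA; have : \forall r \near s, r \in `[0, T] -> A r := wA.
by apply: filterS => r h rt; apply: h; exact: sub.
Qed.

Section exponential_transform.
Context {R : realType} {d : nat} (p q T : R).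
Local Notation mu := (@lebesgue_measure R).
Local Notation dist := (schwartz R d -> R^o).
Context (sigma : 'rV[R]_d -> dist -> 'M[R]_d) (b : 'rV[R]_d -> dist -> 'rV[R]_d).
Context (c : R -> 'rV[R]_d -> (R -> dist) -> R) (u0 : 'rV[R]_d -> dist).
Hypotheses (d0 : (0 < d)%N) (T0 : 0 <= T) (qp : q <= p).
Hypothesis cm : forall x y, hs_path p T y -> measurable_fun `[0, T] (fun s => c s x y).
Hypothesis cl : forall x, exists beta : R, forall t y1 y2, t \in `[0, T] ->
  hs_path p T y1 -> hs_path p T y2 ->
  `|c t x y1 - c t x y2| <= beta * path_norm p (fun s => y1 s - y2 s) t.
Hypothesis cb : forall x (alpha : R), 0 < alpha -> exists M : R, forall t y,
  t \in `[0, T] -> hs_path p T y -> path_norm p y T <= alpha -> `|c t x y| <= M.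
Implicit Types (U : R -> 'rV[R]_d -> dist) (y z : R -> dist).

(** [hat] is a choice and satisfies its equation only if some hat exists, whence the witness [z].
    Uniqueness then identifies the chosen path with [z] on [0, T]. *)
Lemma hatP x y z : hs_path p T y -> is_hat p T c x y z ->
  is_hat p T c x y (hat p T c x y) /\
  (forall t, t \in `[0, T] -> hat p T c x y t = z t).
Proof.
move=> hy hz; have hh : is_hat p T c x y (hat p T c x y).
  by apply: (@getPex _ [set z | is_hat p T c x y z]); exists z.
split=> // t tT; have [pz zE] := hz; have [ph hE] := hh.
exact: (hat_unique T0 (cm x) (cl x) (cb x) hy ph pz hE zE).
Qed.

Lemma solution_II_uhat U : solution_I p q T sigma b u0 U ->
  solution_II p q T sigma b c u0 (uhat c U).
Proof.
move=> solU x; have [hu uI] := solU x.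
have [M hM] := coefficient_bounded T0 (cb x) hu.
pose a t := \int[mu]_(s in `[0, t]) c s x (U ^~ x).
have hv : hs_path p T (uhat c U ^~ x).
  apply: (@hs_pathZ _ _ p T (fun t => expR (a t)) _ (expR (M * T) * M)) => //.
  exact: (@expR_Rintegral_lipschitz R T M a (fun s => c s x (U ^~ x)) T0
    (cm x hu) hM (fun=> erefl)).
(* The two exponentials cancel because both evaluate [c] along the same path [U ^~ x]. This also
   supplies the existence of a hat that [solution_II] demands. *)
have hatu : is_hat p T c x (uhat c U ^~ x) (U ^~ x).
  by split=> // t tT; rewrite /uhat scalerA -expRD addNr expR0 scale1r.
have [[ph hE] hatE] := hatP hv hatu.
split=> //; first by exists (U ^~ x).
move=> t tT; have /andP[t0 tT'] : 0 <= t <= T by rewrite in_itv in tT.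
have sub := subitv_cc tT'.
apply: (@eq_is_bochner _ _ q _ (fun s => expR (a s) *: opL sigma b x (U s x) +
   (c s x (U ^~ x) * expR (a s)) *: U s x)).
  move=> s st; have sT : s \in `[0, T] by exact: sub.
  rewrite /opLhat hatE// (coefficient_ext (cl x) ph hu hatE sT).
  by rewrite /uhat second_orderZ scalerA.
apply: (@is_bochner_expR _ _ p q t M _ (U ^~ x)) => //.
- exact: hs_pathS hu.
- by apply: measurable_funS (cm x hu).
- by move=> s st; apply: hM; exact: sub.
- by move=> s st; apply: uI; exact: sub.
Qed.

Lemma solution_I_hat U : solution_II p q T sigma b c u0 U ->
  solution_I p q T sigma b u0 (fun t x => hat p T c x (U ^~ x) t).
Proof.
move=> solU x; have [hu [z hz] uI] := solU x.
have [[ph hE] _] := hatP hu hz.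
set h := hat p T c x (U ^~ x) in ph hE *.
split=> // t tT; have /andP[t0 tT'] : 0 <= t <= T by rewrite in_itv in tT.
have sub := subitv_cc tT'.
have [M hM] := coefficient_bounded T0 (cb x) ph.
pose a t := \int[mu]_(s in `[0, t]) (- c s x h).
have aE s : s \in `[0, T] -> a s = - \int[mu]_(r in `[0, s]) c r x h.
  move=> sT; rewrite /a -[RHS]mulN1r -RintegralZl//.
    by apply: eq_Rintegral => r _; rewrite mulN1r.
  apply: (@measurable_normr_le_integrable _ _ _ mu _ _ M) => //.
  - exact: lebesgue_itv_lty.
  - apply: measurable_funS (cm x ph) => //; apply: subitv_cc.
    by rewrite in_itv/= in sT; case/andP: sT.
  - by move=> r rs; apply: hM; apply: subitv_cc rs; rewrite in_itv/= in sT; case/andP: sT.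
have hEa s : s \in `[0, T] -> h s = expR (a s) *: U s x by move=> sT; rewrite aE// hE.
rewrite hEa//.
apply: (@eq_is_bochner _ _ q _ (fun s => expR (a s) *: opLhat p T sigma b c s x (U ^~ x) +
   (- c s x h * expR (a s)) *: U s x)).
  move=> s st; have sT : s \in `[0, T] by exact: sub.
  rewrite /opLhat -/h /opL.
  (* The zeroth-order term of [opLhat], multiplied by e^a, cancels the term - c e^a U of the product
     rule. What remains is the second-order part with coefficients frozen at [h], applied to e^a U =
     h. *)
  rewrite [RHS](_ : _ = second_order (sigma x (h s)) (b x (h s)) (expR (a s) *: U s x)).
    by rewrite second_orderZ scalerDr scalerA mulNr scaleNr (mulrC (c s x h)) addrK.
  by rewrite -hEa.
apply: (@is_bochner_expR _ _ p q t M _ (U ^~ x)) => //.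
- exact: hs_pathS hu.
- by apply: measurableT_comp => //; apply: measurable_funS (cm x ph).
- by move=> s st; rewrite normrN; apply: hM; exact: sub.
- by move=> s st; apply: uI; exact: sub.
Qed.

End exponential_transform.
Theorem theorem4p1 (R : realType) (d : nat) (p q T : R)
    (u0 : 'rV[R]_d -> schwartz R d -> R^o)
    (sigma : 'rV[R]_d -> (schwartz R d -> R^o) -> 'M[R]_d)
    (b : 'rV[R]_d -> (schwartz R d -> R^o) -> 'rV[R]_d)
    (c : R -> 'rV[R]_d -> (R -> schwartz R d -> R^o) -> R) :
  (0 < d)%N -> 0 < T -> q <= p - 1 ->
  hs_measurable p u0 ->
  (forall i j, local_lipschitz p q (fun x f => sigma x f i j)) ->
  (forall i, local_lipschitz p q (fun x f => b x f 0 i)) ->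
  (forall x y, hs_path p T y -> measurable_fun `[0, T] (fun s => c s x y)) ->
  (forall x, exists beta : R, forall t y1 y2, t \in `[0, T] ->
    hs_path p T y1 -> hs_path p T y2 ->
    `|c t x y1 - c t x y2| <= beta * path_norm p (fun s => y1 s - y2 s) t) ->
  (forall x (alpha : R), 0 < alpha -> exists M : R, forall t y,
    t \in `[0, T] -> hs_path p T y -> path_norm p y T <= alpha ->
    `|c t x y| <= M) ->
  (forall U, solution_I p q T sigma b u0 U ->
    solution_II p q T sigma b c u0 (uhat c U)) /\
  (uniquely_solvable T (solution_I p q T sigma b u0) ->
   uniquely_solvable T (solution_II p q T sigma b c u0)).
Proof.
move=> d0 T_gt0 qp1 _ _ _ cm cl cb.
have T0 := ltW T_gt0.
have qp : q <= p by rewrite (le_trans qp1)// gerBl.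
have uhat_sol U := @solution_II_uhat R d p q T sigma b c u0 d0 T0 qp cm cl cb U.
have hat_sol U := @solution_I_hat R d p q T sigma b c u0 d0 T0 qp cm cl cb U.
split=> // -[[U solU] uniqI]; split; first by exists (uhat c U); exact: uhat_sol.
move=> V W solV solW t x tT.
have [hV [zV hzV] _] := solV x; have [hW [zW hzW] _] := solW x.
have [[pV VE] _] := hatP T0 cm cl cb hV hzV.
have [[pW WE] _] := hatP T0 cm cl cb hW hzW.
have VW s : s \in `[0, T] -> hat p T c x (V ^~ x) s = hat p T c x (W ^~ x) s.
  exact: uniqI _ _ (hat_sol V solV) (hat_sol W solW) s x.
(* The exponent is evaluated along the hat, so the hat alone determines the path it came from. *)
have inv y z : is_hat p T c x y z ->
    y t = expR (\int[lebesgue_measure]_(s in `[0, t]) c s x z) *: z t.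
  by move=> [_ /(_ t tT) ->]; rewrite scalerA -expRD addrN expR0 scale1r.
have eV := inv (V ^~ x) (hat p T c x (V ^~ x)) (conj pV VE).
have eW := inv (W ^~ x) (hat p T c x (W ^~ x)) (conj pW WE).
rewrite [LHS]eV [RHS]eW.
rewrite (VW t tT).
suff -> : \int[lebesgue_measure]_(s in `[0, t]) c s x (hat p T c x (V ^~ x)) =
    \int[lebesgue_measure]_(s in `[0, t]) c s x (hat p T c x (W ^~ x)) by [].
(* Uniqueness for (I) equates the two hats on [0, T] only, so [c] along them is compared by
   [coefficient_ext] and not by rewriting. *)
apply: eq_Rintegral => s /set_mem st.
apply: (coefficient_ext (cl x) pV pW VW).
by apply: subitv_cc st; move: tT; rewrite in_itv/= => /andP[].
Qed.
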